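(* Let $X$ and $Y$ be Banach spaces and let $(S,T)\in RP(X,Y)$ be a regular Fredholm pair whose case is $III-n$ with number $n=q=p-1\ge 2$. Then there is an adapted decomposition system $(X_1,X_2,\tilde X;Y_1,Y_2,\tilde Y)$ of $(S,T)$ such that, for the subspaces associated with it, $$X=\Big[X_1\oplus\bigoplus_{i=1}^{q-1}\mathbb N^i\Big]\oplus\Big[X_2^{q}\oplus\bigoplus_{i=1}^{q-1}\mathbb X_2^i\Big]\oplus[\tilde X_N\oplus\tilde X_2],$$ $$Y=\Big[Y_1\oplus\bigoplus_{j=1}^{q}\mathbb M^j\Big]\oplus\Big[Y_2^{q-1}\oplus\bigoplus_{j=1}^{q-2}\mathbb Y_2^j\Big]\oplus[\tilde Y_N\oplus\tilde Y_2],$$ and $S$ and $T$ act as follows (every ''$\xrightarrow{\cong}$'' being the indicated restriction, and an isomorphism of Banach spaces; items whose superscript index is less than $1$ are omitted): $S|_{X_1\oplus\bigoplus_{i=1}^{q-1}\mathbb N^i}\equiv 0$, $S\colon X_2^{q}\xrightarrow{\cong}Y_2^{q-1}$, $S\colon\mathbb X_2^i\xrightarrow{\cong}\mathbb M^{i+1}\oplus\mathbb Y_2^{i+1}$ for $i=1,\dots,q-3$, $S\colon\mathbb X_2^{k}\xrightarrow{\cong}\mathbb M^{k+1}$ for $k=q-2,\,q-1$, $S\colon\tilde X_N\xrightarrow{\cong}\mathbb M^1$, $S\colon\tilde X_2\xrightarrow{\cong}\mathbb Y_2^1$; $T|_{Y_1\oplus\bigoplus_{j=1}^{q}\mathbb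 M^j}\equiv 0$, $T\colon Y_2^{q-1}\xrightarrow{\cong}X_2^{q}$, $T\colon\mathbb Y_2^j\xrightarrow{\cong}\mathbb N^{j+1}\oplus\mathbb X_2^{j+1}$ for $j=1,\dots,q-2$, $T\colon\tilde Y_N\xrightarrow{\cong}\mathbb N^1$, $T\colon\tilde Y_2\xrightarrow{\cong}\mathbb X_2^1$. In addition, if $q=2$, then $\mathbb Y_2^1$ and $\tilde X_2$ are null spaces.
   Context: $L(X,Y)$ is the space of bounded linear operators from $X$ to $Y$; $N(\cdot)$ and $R(\cdot)$ denote null space and range; $\mathbb N=\{1,2,\dots\}$, $\mathbb N_0=\mathbb N\cup\{0\}$. Regular Fredholm pairs. For $S\in L(X,Y)$, $T\in L(Y,X)$, $(S,T)$ is a Fredholm pair if $N(S)/(N(S)\cap R(T))$, $R(T)/(N(S)\cap R(T))$, $N(T)/(N(T)\cap R(S))$, $R(S)/(N(T)\cap R(S))$ are all finite dimensional. An operator $T\in L(Y,X)$ is regular if $T=TT'T$ for some $T'\in L(X,Y)$. $RP(X,Y)$ is the set of Fredholm pairs $(S,T)$ with both $S$ and $T$ regular. Number and case. Put $R_{S,0}=Y$, $R_{T,0}=X$, $R_{S,n+1}=S(R_{T,n})$, $R_{T,n+1}=T(R_{S,n})$ for $n\in\mathbb N_0$. These are decreasing sequences of subspaces, finite dimensional for $n\ge 2$. Let $p$ (resp. $q$) be the smallest element of $\mathbb N$ with $R_{S,p}=R_{S,p+k}$ (resp. $R_{T,q}=R_{T,q+k}$) for all $k\ge 0$; always $|p-q|\le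 1$. The number of $(S,T)$ is $n=\min\{p,q\}$, and its case is $I-n$ if $p=q$, $II-n$ if $p<q$, $III-n$ if $q<p$. Decomposition systems. A decomposition system of $(S,T)\in RP(X,Y)$ consists of finite dimensional subspaces $X_1,X_2\subseteq X$, $Y_1,Y_2\subseteq Y$ and closed subspaces $\tilde X\subseteq X$, $\tilde Y\subseteq Y$ with $N(S)=(N(S)\cap R(T))\oplus X_1$, $R(T)=(N(S)\cap R(T))\oplus X_2$, $X=((N(S)\cap R(T))\oplus X_1\oplus X_2)\oplus\tilde X$, $N(T)=(N(T)\cap R(S))\oplus Y_1$, $R(S)=(N(T)\cap R(S))\oplus Y_2$, $Y=((N(T)\cap R(S))\oplus Y_1\oplus Y_2)\oplus\tilde Y$. With it are associated, for $n\in\mathbb N$: $M^n=R_{S,n}\cap N(T)$, $N^n=R_{T,n}\cap N(S)$, $Y_2^n=R_{S,n}\cap Y_2$, $X_2^n=R_{T,n}\cap X_2$; $R_{\tilde S,1}=S(\tilde X)$, $R_{\tilde T,1}=T(\tilde Y)$, $R_{\tilde S,n+1}=S(R_{\tilde T,n})$, $R_{\tilde T,n+1}=T(R_{\tilde S,n})$; $\mathbb M^n=R_{\tilde S,n}\cap N(T)$, $\mathbb N^n=R_{\tilde T,n}\cap N(S)$, $\mathbb Y_2^n=R_{\tilde S,n}\cap Y_2^n$, $\mathbb X_2^n=R_{\tilde T,n}\cap X_2^n$ (here $\mathbb N^n$ is a subspace of $X$, not a power of the natural numbers); $\tilde X_N=\{x\in\tilde X: Sx\in\mathbb M^1\}$,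 $\tilde X_2=\{x\in\tilde X: Sx\in\mathbb Y_2^1\}$, $\tilde Y_N=\{y\in\tilde Y: Ty\in\mathbb N^1\}$, $\tilde Y_2=\{y\in\tilde Y: Ty\in\mathbb X_2^1\}$. The system is called adapted if for all $n\in\mathbb N$: $R_{S,n}=M^n\oplus Y_2^n$, $R_{T,n}=N^n\oplus X_2^n$, $R_{\tilde S,n}=\mathbb M^n\oplus\mathbb Y_2^n$, $R_{\tilde T,n}=\mathbb N^n\oplus\mathbb X_2^n$, $R_{S,n}=R_{S,n+1}\oplus R_{\tilde S,n}$, $R_{T,n}=R_{T,n+1}\oplus R_{\tilde T,n}$. *)

(* Defs.v *)
From HB Require Import structures.
From mathcomp Require Import all_boot all_order all_algebra.
From mathcomp Require Import complex.
From mathcomp Require Import all_classical all_reals all_analysis.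

Set Implicit Arguments.
Unset Strict Implicit.
Unset Printing Implicit Defensive.

Import Order.TTheory GRing.Theory Num.Theory.
Import numFieldNormedType.Exports.

Local Open Scope classical_set_scope.
Local Open Scope ring_scope.

(* The scalar field of a Banach space is the field of real numbers or the
   field of complex numbers; X : completeNormedModType K is then a Banach
   space over K. *)
Variant scalar_field (R : realType) : numFieldType -> Prop :=
| RealScalars : scalar_field R R
| ComplexScalars : scalar_field R R[i].

Section Subspaces.
Context {K : numFieldType} {V : normedModType K}.
Implicit Types (A B U : set V) (s : seq (set V)).

Definition is_subspace A := GRing.submod_closed [in A].

(* U / A is finite dimensional: finitely many vectors of U span U modulo A. *)
Definition finite_dim_quotient U A :=
  exists (n : nat) (v : 'I_n -> V), (forall i, U (v i)) /\
    forall x, U x -> exists c : 'I_n -> K, A (x - \sum_(i < n) c i *: v i).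

Definition finite_dim A := is_subspace A /\ finite_dim_quotient A [set 0].

Definition add_set A B : set V := [set a + b | a in A & b in B].

Definition sum_set s : set V := foldr add_set [set 0] s.

Fixpoint independent s : Prop :=
  if s is A :: s' then A `&` sum_set s' = [set 0] /\ independent s' else True.

(* U is the internal direct sum of the subspaces in s (U = {0} if s = [::]). *)
Definition direct_sum U s := U = sum_set s /\ independent s.

End Subspaces.

Section Operators.
Context {K : numFieldType} {V W : normedModType K}.

Definition null_space (f : V -> W) : set V := f @^-1` [set 0].

Definition regular (f : {linear V -> W}) :=
  exists2 g : {linear W -> V}, continuous g & forall x, f x = f (g (f x)).

(* f restricts to an isomorphism of Banach spaces from A onto B: A and B are
   closed subspaces of the ambient Banach spaces, and the restriction of f is
   a bijection from A onto B, continuous together with its inverse g. *)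
Definition banach_iso (f : {linear V -> W}) (A : set V) (B : set W) :=
  [/\ is_subspace A /\ closed A, is_subspace B /\ closed B, set_bij A B f,
      {within A, continuous f} &
      exists2 g : W -> V, forall x, A x -> g (f x) = x
                        & {within B, continuous g}].

End Operators.

(* The positive naturals being the index set, [k] ranges from 1. *)
Definition stab_index {V : Type} (R : nat -> set V) (k : nat) :=
  let stable m := (1 <= m)%N /\ forall l, R m = R (m + l)%N in
  stable k /\ forall m, stable m -> (k <= m)%N.

Variant pair_case := CaseI | CaseII | CaseIII.

Section Pairs.
Context {K : numFieldType} {X Y : normedModType K}.
Variables (S : {linear X -> Y}) (T : {linear Y -> X}).

Definition fredholm_pair :=
  [/\ finite_dim_quotient (null_space S) (null_space S `&` range T),
      finite_dim_quotient (range T) (null_space S `&` range T),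
      finite_dim_quotient (null_space T) (null_space T `&` range S) &
      finite_dim_quotient (range S) (null_space T `&` range S)].

Definition regular_fredholm_pair :=
  [/\ continuous S, continuous T, fredholm_pair, regular S & regular T].

(* The alternating images: B, S(A), S(T(B)), ... in Y and A, T(B), T(S(A)), ...
   in X. *)
Fixpoint altS (A : set X) (B : set Y) (n : nat) : set Y :=
  if n is m.+1 then S @` altT A B m else B
with altT (A : set X) (B : set Y) (n : nat) : set X :=
  if n is m.+1 then T @` altS A B m else A.

Definition R_S : nat -> set Y := altS setT setT.
Definition R_T : nat -> set X := altT setT setT.

Definition has_case (c : pair_case) (n : nat) :=
  exists p q : nat,
    [/\ stab_index R_S p, stab_index R_T q, n = minn p q &
        match c with
        | CaseI => p = q
        | CaseII => (p < q)%N
        | CaseIII => (q < p)%N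
        end].

Record system := System {
  X1 : set X; X2 : set X; Xt : set X;
  Y1 : set Y; Y2 : set Y; Yt : set Y }.

Record decomposition_system (D : system) : Prop := {
  dec_X1 : finite_dim (X1 D);
  dec_X2 : finite_dim (X2 D);
  dec_Xt : is_subspace (Xt D) /\ closed (Xt D);
  dec_Y1 : finite_dim (Y1 D);
  dec_Y2 : finite_dim (Y2 D);
  dec_Yt : is_subspace (Yt D) /\ closed (Yt D);
  dec_NS : direct_sum (null_space S) [:: null_space S `&` range T; X1 D];
  dec_RT : direct_sum (range T) [:: null_space S `&` range T; X2 D];
  dec_X : direct_sum setT [:: null_space S `&` range T; X1 D; X2 D; Xt D];
  dec_NT : direct_sum (null_space T) [:: null_space T `&` range S; Y1 D];
  dec_RS : direct_sum (range S) [:: null_space T `&` range S; Y2 D];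
  dec_Y : direct_sum setT [:: null_space T `&` range S; Y1 D; Y2 D; Yt D] }.

Section Associated.
Variable D : system.

(* The suffix t stands for a tilde, a doubled letter for a blackboard bold one.
   These are only used for n >= 1; in particular Rt_S 1 = S(Xt) and
   Rt_T 1 = T(Yt). *)
Definition Rt_S : nat -> set Y := altS (Xt D) (Yt D).
Definition Rt_T : nat -> set X := altT (Xt D) (Yt D).

Definition Mn n := R_S n `&` null_space T.
Definition Nn n := R_T n `&` null_space S.
Definition Y2n n := R_S n `&` Y2 D.
Definition X2n n := R_T n `&` X2 D.

Definition MM n := Rt_S n `&` null_space T.
Definition NN n := Rt_T n `&` null_space S.
Definition YY2 n := Rt_S n `&` Y2n n.
Definition XX2 n := Rt_T n `&` X2n n.

Definition XtN : set X := [set x | Xt D x /\ MM 1%N (S x)].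
Definition Xt2 : set X := [set x | Xt D x /\ YY2 1%N (S x)].
Definition YtN : set Y := [set y | Yt D y /\ NN 1%N (T y)].
Definition Yt2 : set Y := [set y | Yt D y /\ XX2 1%N (T y)].

Definition adapted := forall n : nat, (1 <= n)%N ->
  [/\ direct_sum (R_S n) [:: Mn n; Y2n n] /\ direct_sum (R_T n) [:: Nn n; X2n n],
      direct_sum (Rt_S n) [:: MM n; YY2 n],
      direct_sum (Rt_T n) [:: NN n; XX2 n],
      direct_sum (R_S n) [:: R_S n.+1; Rt_S n] &
      direct_sum (R_T n) [:: R_T n.+1; Rt_T n]].

End Associated.
End Pairs.
Arguments system {K} X Y.

(* Main.v *)
From HB Require Import structures.
Require Import Defs.
From mathcomp Require Import all_boot all_order all_algebra.
From mathcomp Require Import complex.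
From mathcomp Require Import all_classical all_reals all_analysis.
From mathcomp Require Import ring lra.

(** The chains [R_S] and [R_T] are linked by R_S (n+1) = S (R_T n) and
R_T (n+1) = T (R_S n), so T induces a surjection from R_S n / R_S (n+1) onto
R_T (n+1) / R_T (n+2), and S one in the other direction.  An adapted system is
a simultaneous linear lift of all these surjections: Rt_S n and Rt_T n are
complements representing the quotients, T maps Rt_S n onto Rt_T (n+1), and
Rt_S n splits into its intersections with the null space of T and with Y2,
where T is injective.  Such a lift has to be chosen from the deep end.  Where
both chains have become constant the quotients vanish and there is nothing to
choose.  From level n+1 one gets to level n by [stage_lift]: pull the
complement already chosen in R_T (n+1) back into a complement of the null space
of T in R_S n, and add a complement of M^(n+1) in M^n.  Going down to level 1
([exists_adapted_from]) produces Rt_S 1, Y2, Rt_T 1 and X2.  With S' a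
continuous generalized inverse of S, the subspace Xt = S'(Rt_S 1) is then a
closed complement of N(S) + X2 on which S' inverts S, and likewise for Yt
([decomposition_half]).

Only level 1 can be infinite dimensional.  There, closed complements of finite
dimensional subspaces come from the Hahn-Banach theorem, which is proved by
Zorn's lemma for real-linear functionals and then complexified when the scalars
are complex.  Its consequence [fin_dim_left_inverse], a continuous left inverse
of an operator that is injective on a finite dimensional subspace, provides the
projections, the closedness of finite dimensional subspaces, and the continuous
inverses of all the finite dimensional restrictions.

In case III with number q, the chain R_T is constant from q on.  R_T q is finite
dimensional and is mapped onto itself by T S, so T S is injective on it
([fin_dim_surj_inj]); hence N^q = 0 and M^(q+1) = 0.  Moreover Rt_T j = 0 for
j >= q, and therefore YY2 j = 0 for j >= q-1.  The refined decompositions of X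
and Y arise by iterating N^n = NN^n + N^(n+1) and X2^n = XX2^n + X2^(n+1)
([stage_chain], [refined_decomposition]), and the isomorphisms are read off from
the relations between consecutive levels. *)

Set Implicit Arguments.
Unset Strict Implicit.
Unset Printing Implicit Defensive.

Import Order.TTheory GRing.Theory Num.Theory.
Import numFieldNormedType.Exports.

Local Open Scope classical_set_scope.
Local Open Scope ring_scope.

(** * Subspaces and internal direct sums *)

Section SubspaceAlgebra.
Context {K : numFieldType} {V : normedModType K}.
Implicit Types (A B U Z : set V) (s t : seq V) (r l : seq (set V)).

Lemma is_subspaceP A :
  is_subspace A <-> A 0 /\ forall a u v, A u -> A v -> A (a *: u + v).
Proof.
split=> [[A0 AD]|[A0 AD]]; split.
- by move: A0; rewrite inE.
- by move=> a u v Au Av; move: (AD a u v); rewrite !inE; apply.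
- by rewrite inE.
- by move=> a u v; rewrite !inE; apply: AD.
Qed.

Lemma subspace0 A : is_subspace A -> A 0.
Proof. by case/is_subspaceP. Qed.

Lemma subspaceZD A a u v : is_subspace A -> A u -> A v -> A (a *: u + v).
Proof. by case/is_subspaceP=> _; apply. Qed.

Lemma subspaceD A u v : is_subspace A -> A u -> A v -> A (u + v).
Proof. by move=> sA Au Av; rewrite -[u]scale1r; apply: subspaceZD. Qed.

Lemma subspaceZ A a u : is_subspace A -> A u -> A (a *: u).
Proof.
by move=> sA Au; rewrite -[_ *: _]addr0; apply: subspaceZD => //; exact: subspace0.
Qed.

Lemma subspaceN A u : is_subspace A -> A u -> A (- u).
Proof. by move=> sA Au; rewrite -scaleN1r; apply: subspaceZ. Qed.

Lemma subspaceB A u v : is_subspace A -> A u -> A v -> A (u - v).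
Proof. by move=> sA Au Av; apply: subspaceD => //; apply: subspaceN. Qed.

Lemma subspace_set0 : is_subspace [set 0 : V].
Proof.
by apply/is_subspaceP; split=> // a u v /= -> ->; rewrite scaler0 addr0.
Qed.

Lemma subspace_setT : is_subspace [set: V].
Proof. exact/is_subspaceP. Qed.

Lemma subspaceI A B : is_subspace A -> is_subspace B -> is_subspace (A `&` B).
Proof.
move=> sA sB; apply/is_subspaceP; split; first by split; apply: subspace0.
by move=> a u v [Au Bu] [Av Bv]; split; apply: subspaceZD.
Qed.

Lemma subspace_add A B :
  is_subspace A -> is_subspace B -> is_subspace (add_set A B).
Proof.
move=> sA sB; apply/is_subspaceP; split.
  by exists 0; [exact: subspace0|exists 0; [exact: subspace0|rewrite addr0]].
move=> a _ _ [u Au [v Bv <-]] [u' Au' [v' Bv' <-]].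
exists (a *: u + u'); first exact: subspaceZD.
by exists (a *: v + v'); [exact: subspaceZD|rewrite scalerDr addrACA].
Qed.

Lemma add_setC A B : add_set A B = add_set B A.
Proof.
by apply/seteqP; split=> _ [a Aa [b Bb <-]]; exists b => //; exists a => //;
  rewrite addrC.
Qed.

Lemma add_setA A B U : add_set A (add_set B U) = add_set (add_set A B) U.
Proof.
apply/seteqP; split.
  move=> _ [a Aa [_ [b Bb [u Uu <-]] <-]].
  by exists (a + b); [exists a => //; exists b|exists u => //; rewrite addrA].
move=> _ [_ [a Aa [b Bb <-]] [u Uu <-]].
by exists a => //; exists (b + u); [exists b => //; exists u|rewrite addrA].
Qed.

Lemma add_set0 A : add_set A [set 0] = A.
Proof.
apply/seteqP; split=> [_ [a Aa [_ -> <-]]|a Aa]; first by rewrite addr0.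
by exists a => //; exists 0 => //; rewrite addr0.
Qed.

Lemma add_0set A : add_set [set 0] A = A.
Proof. by rewrite add_setC add_set0. Qed.

Lemma sub_addl A B : is_subspace B -> A `<=` add_set A B.
Proof.
by move=> sB a Aa; exists a => //; exists 0; [exact: subspace0|rewrite addr0].
Qed.

Lemma sub_addr A B : is_subspace A -> B `<=` add_set A B.
Proof. by move=> sA; rewrite add_setC; apply: sub_addl. Qed.

Fixpoint subspaces (r : seq (set V)) : Prop :=
  if r is A :: r' then is_subspace A /\ subspaces r' else True.

Lemma subspaces_cat r r' :
  subspaces (r ++ r') <-> subspaces r /\ subspaces r'.
Proof. by elim: r => [|A r IH] /=; [tauto|rewrite IH; tauto]. Qed.

Lemma subspaces_map (F : nat -> set V) (l : seq nat) :
  (forall i, is_subspace (F i)) -> subspaces [seq F i | i <- l].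
Proof. by move=> sF; elim: l. Qed.

Lemma subspace_sum r : subspaces r -> is_subspace (sum_set r).
Proof.
elim: r => [_|A r IH [sA sr]] /=; first exact: subspace_set0.
by apply: subspace_add => //; apply: IH.
Qed.

Lemma sum_set_cat r r' : sum_set (r ++ r') = add_set (sum_set r) (sum_set r').
Proof. by elim: r => [|A r IH] /=; rewrite ?add_0set // IH add_setA. Qed.

(** An equality of propositions, so that it can be rewritten inside conjunctions
of any arity. *)
Lemma setI_trivialE A B : is_subspace A -> is_subspace B ->
  (A `&` B = [set 0]) = (forall x, A x -> B x -> x = 0).
Proof.
move=> sA sB; apply/propext; split=> [AB x Ax Bx|AB].
  by have: (A `&` B) x by []; rewrite AB.
apply/seteqP; split=> [x [] /AB|_ ->]; first by move=> h /h ->.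
by split; apply: subspace0.
Qed.

Lemma independent_cat r r' : subspaces r -> subspaces r' ->
  independent (r ++ r') <->
  [/\ independent r, independent r'
    & forall x, sum_set r x -> sum_set r' x -> x = 0].
Proof.
move=> + sr'; elim: r => [_|A r IH [sA sr]] /=.
  by split=> [ir'|[]//]; split=> // x ->.
have sS := subspace_sum sr; have sS' := subspace_sum sr'.
rewrite sum_set_cat (setI_trivialE sA (subspace_add sS sS')).
rewrite (setI_trivialE sA sS) IH //.
split=> [[iA [ir ir' irr']]|[[iA ir] ir' iArr']].
  split=> //; first by split=> // x Ax rx; apply: iA => //; apply: sub_addl.
  move=> _ [a Aa [u ru <-]] ux.
  have a0 : a = 0.
    apply: iA => //; exists (- u); first exact: subspaceN.
    by exists (a + u) => //; rewrite addrC addrK.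
  by move: ux; rewrite a0 add0r; apply: irr'.
split.
  move=> x Ax [u ru [v rv xE]].
  have v0 : v = 0.
    apply: iArr' => //; exists x => //; exists (- u); first exact: subspaceN.
    by rewrite -xE addrC addKr.
  by apply: iA => //; rewrite -xE v0 addr0.
split=> // x rx r'x; apply: iArr' => //.
by apply: sub_addr.
Qed.

Lemma direct_sum_catC U r r' : subspaces r -> subspaces r' ->
  direct_sum U (r ++ r') -> direct_sum U (r' ++ r).
Proof.
move=> sr sr' [-> /independent_cat[]// ir ir' irr']; split.
  by rewrite !sum_set_cat add_setC.
by apply/independent_cat => //; split=> // x; move=> h h'; apply: irr'.
Qed.

Lemma direct_sum_catCA U r r' l : subspaces r -> subspaces r' -> subspaces l ->
  direct_sum U (r ++ r' ++ l) -> direct_sum U (r' ++ r ++ l).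
Proof.
move=> sr sr' sl; rewrite !catA => -[-> /independent_cat[]//].
  exact/subspaces_cat.
move=> irr' il irl.
have [rE irr] := direct_sum_catC sr sr' (conj erefl irr').
have E : sum_set (r' ++ r) = sum_set (r ++ r') by rewrite -rE.
split; first by rewrite sum_set_cat -E -sum_set_cat.
by apply/independent_cat; rewrite ?E //; apply/subspaces_cat.
Qed.

(** A summand may be replaced by the summands of any decomposition of it; this is
the step by which coarse decompositions are refined. *)
Lemma direct_sum_subst U A r l r' : subspaces l -> is_subspace A ->
  subspaces r -> subspaces r' ->
  direct_sum U (l ++ A :: r') -> direct_sum A r -> direct_sum U (l ++ r ++ r').
Proof.
move=> sl sA sr sr' [UE iU] [AE ir]; split.
  by rewrite UE !sum_set_cat /= AE.
move: iU => /independent_cat[]//= il [iA ir'] ilA.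
apply/independent_cat => //; first exact/subspaces_cat.
split=> //; last by rewrite sum_set_cat -AE.
apply/independent_cat => //; split=> // x; rewrite -AE.
by move: x; rewrite -setI_trivialE //; apply: subspace_sum.
Qed.

Lemma direct_sum_rcons0 U r : subspaces r ->
  direct_sum U (r ++ [:: [set 0]]) -> direct_sum U r.
Proof.
move=> sr [UE /independent_cat[]//]; first by split=> //; exact: subspace_set0.
by move=> ir _ _; split=> //; rewrite UE sum_set_cat /= !add_set0.
Qed.

(** The elementwise form of the direct sum of two subspaces. *)
Definition splits U A B :=
  [/\ A `<=` U, B `<=` U,
      forall u, U u -> exists a b, [/\ A a, B b & u = a + b]
    & forall x, A x -> B x -> x = 0].

Lemma splits_direct_sum U A B : is_subspace U -> is_subspace A ->
  is_subspace B -> splits U A B -> direct_sum U [:: A; B].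
Proof.
move=> sU sA sB [AU BU UAB AB0]; split=> /=.
  rewrite add_set0; apply/seteqP; split=> [u /UAB[a [b [Aa Bb ->]]]|].
    by exists a => //; exists b.
  by move=> _ [a Aa [b Bb <-]]; apply: subspaceD; auto.
rewrite add_set0; split; first by rewrite setI_trivialE.
by split=> //; rewrite setI_trivialE //; exact: subspace_set0.
Qed.

Lemma splitsC U A B : splits U A B -> splits U B A.
Proof.
move=> [AU BU UAB AB0]; split=> //; last by move=> x Bx Ax; apply: AB0.
by move=> u /UAB[a [b [Aa Bb ->]]]; exists b, a; split=> //; rewrite addrC.
Qed.

Lemma splits_set0r U : is_subspace U -> splits U U [set 0].
Proof.
move=> sU; split=> [//|_ ->|u Uu|x _ ->//]; first exact: subspace0.
by exists u, 0; split; rewrite ?addr0.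
Qed.

(** * Finite codimension and finite dimension *)

(** The sum of A and of the linear span of s; the recursive form makes induction
on the number of vectors immediate. *)
Fixpoint cospan A s : set V :=
  if s is v :: s' then [set x | exists c : K, cospan A s' (x - c *: v)] else A.

Lemma subspace_cospan A s : is_subspace A -> is_subspace (cospan A s).
Proof.
move=> sA; elim: s => [//|v s sS] /=; apply/is_subspaceP; split.
  by exists 0; rewrite scale0r subr0; apply: subspace0.
move=> a x y [c Sx] [d Sy]; exists (a * c + d).
have -> : a *: x + y - (a * c + d) *: v
  = a *: (x - c *: v) + (y - d *: v).
  by rewrite scalerBr scalerA scalerDl opprD addrACA.
exact: subspaceZD.
Qed.

Lemma sub_cospan A s : A `<=` cospan A s.
Proof.
elim: s => [//|v s IH] x Ax; exists 0; rewrite scale0r subr0; exact: IH.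
Qed.

Lemma cospan_sub A B s : A `<=` B -> cospan A s `<=` cospan B s.
Proof. by move=> AB; elim: s => [//|v s IH] x [c /IH ?]; exists c. Qed.

Lemma cospan_sum (I : Type) (l : seq I) (v : I -> V) (c : I -> K) A x :
  A (x - \sum_(i <- l) c i *: v i) -> cospan A (map v l) x.
Proof.
elim: l x => [|i l IH] x /=; first by rewrite big_nil subr0.
by rewrite big_cons opprD addrA => /IH; exists (c i).
Qed.

Lemma cospanP A s x : cospan A s x ->
  exists c : 'I_(size s) -> K, A (x - \sum_(i < size s) c i *: s`_i).
Proof.
elim: s x => [x Ax|v s IH x [c /IH[d Ad]]] /=.
  by exists (fun=> 0); rewrite big_ord0 subr0.
exists (fun i => if unlift ord0 i is Some j then d j else c).
rewrite big_ord_recl unlift_none /= opprD addrA.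
by under eq_bigr => i _ do rewrite liftK /=.
Qed.

Lemma cospan_mem s i : (i < size s)%N -> cospan [set 0] s s`_i.
Proof.
elim: s i => [//|v s IH] [|i] /= ilt; last first.
  by exists 0; rewrite scale0r subr0; apply: IH.
exists 1; rewrite scale1r subrr.
by apply: subspace0; apply: subspace_cospan; exact: subspace_set0.
Qed.

(** Induction on s.  If B is not contained in the span of A and the tail of s, one
vector b of B outside of it suffices to extend the complement found for the
intersection, since modulo b every element of B falls into that intersection.
With A = 0 this shows that subspaces of finite dimensional spaces have finite
spanning families of their own. *)
Lemma exists_complement A B s : is_subspace A -> is_subspace B ->
  B `<=` cospan A s -> exists t, splits B (B `&` A) (cospan [set 0] t).
Proof.
move=> sA; elim: s B => [|v s IH] B sB /= BA.
  exists [::]; rewrite /= (_ : B `&` A = B); first exact: splits_set0r.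
  exact/setIidPl.
have sC := subspace_cospan s sA.
have [t] := IH _ (subspaceI sB sC) (@subIsetr _ _ _).
have -> : B `&` cospan A s `&` A = B `&` A.
  by rewrite -setIA [_ `&` A]setIidr //; apply: sub_cospan.
move=> [_ tB Bt At].
have [BC|] := pselect (B `<=` cospan A s).
  exists t; split=> // [x /tB[]//|u Bu].
  by apply: Bt; split=> //; exact: BC.
move/existsNP => [b /not_implyP[Bb nCb]].
have [d Cd] := BA _ Bb.
have d0 : d != 0 by apply/eqP => d0; apply: nCb; move: Cd; rewrite d0 scale0r subr0.
exists (b :: t); split=> //.
- by move=> x /= [c /tB[Bx _]]; rewrite -[x](subrK (c *: b)); apply: subspaceD => //;
    apply: subspaceZ.
- move=> u Bu; have [c Cc] := BA _ Bu.
  have /Bt[a [f [Ba tf uE]]] : (B `&` cospan A s) (u - (c / d) *: b).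
    split; first by apply: subspaceB => //; apply: subspaceZ.
    have -> : u - (c / d) *: b = (- (c / d)) *: (b - d *: v) + (u - c *: v).
      rewrite scalerBr scalerA mulNr -mulrA mulVf // mulr1 scaleNr scaleNr opprK.
      by rewrite addrACA subrr addr0 addrC.
    exact: subspaceZD.
  exists a, (f + (c / d) *: b); split=> //.
    by exists (c / d); rewrite addrK.
  by rewrite addrA -uE subrK.
- move=> x [Bx Ax] /= [c tx].
  have c0 : c = 0.
    apply/eqP; apply: contrapT => /negP c0; apply: nCb.
    have [_ Cx] := tB _ tx.
    have -> : b = c^-1 *: (x - (x - c *: b)).
      by rewrite opprB addrC subrK scalerA mulVf // scale1r.
    by apply: subspaceZ => //; apply: subspaceB => //; apply: sub_cospan.
  by apply: At => //; move: tx; rewrite c0 scale0r subr0.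
Qed.

(** The spanning vectors may lie outside of U, so that the property passes to
subspaces. *)
Definition fin_dim U := is_subspace U /\ exists s, U `<=` cospan [set 0] s.

Lemma fin_dim_cospan s : fin_dim (cospan [set 0] s).
Proof. by split; [apply: subspace_cospan; exact: subspace_set0|exists s]. Qed.

Lemma fin_dim_sub A U : is_subspace A -> A `<=` U -> fin_dim U -> fin_dim A.
Proof. by move=> sA AU [_ [s Us]]; split=> //; exists s => x /AU/Us. Qed.

Lemma fin_dimE U : fin_dim U -> exists s, U = cospan [set 0] s.
Proof.
move=> [sU [s Us]].
have [t [_ tU Ut _]] := exists_complement subspace_set0 sU Us.
exists t; apply/seteqP; split=> // u /Ut[a [b [[_ ->] tb ->]]].
by rewrite add0r.
Qed.

Lemma fin_dim_finite_dim U : fin_dim U -> finite_dim U.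
Proof.
move=> fU; split; first by case: fU.
have [s ->] := fin_dimE fU.
exists (size s), (fun i => s`_i); split=> [i|x /cospanP//].
exact: cospan_mem.
Qed.

Lemma finite_dim_quotient_cospan U A :
  finite_dim_quotient U A -> exists s, U `<=` cospan A s.
Proof.
move=> [n [v [_ UA]]]; exists (map v (index_enum 'I_n)) => x /UA[c Ac].
exact: (cospan_sum Ac).
Qed.

Lemma finite_dim_fin_dim U : finite_dim U -> fin_dim U.
Proof. by move=> [sU /finite_dim_quotient_cospan]. Qed.

Lemma direct_sum_sub U A B : is_subspace A -> is_subspace B ->
  direct_sum U [:: A; B] -> A `<=` U /\ B `<=` U.
Proof.
move=> sA sB [-> _] /=; rewrite add_set0.
by split; [exact: sub_addl|exact: sub_addr].
Qed.

(** The shape of the list is that of the summands killed by S or by T. *)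
Lemma sum_set_sub U A (F : nat -> set V) (r : seq nat) : is_subspace U ->
  A `<=` U -> (forall i, F i `<=` U) -> sum_set (A :: [seq F i | i <- r]) `<=` U.
Proof.
move=> sU AU FU.
have rU : sum_set [seq F i | i <- r] `<=` U.
  elim: r => [|i r IH] /=; first by move=> _ ->; exact: subspace0.
  by move=> _ [a /FU Ua [b /IH Ub <-]]; exact: subspaceD.
by move=> _ /= [a /AU Ua [b /rU Ub <-]]; exact: subspaceD.
Qed.

End SubspaceAlgebra.

Section Images.
Context {K : numFieldType} {V W : normedModType K}.
Implicit Types (f : {linear V -> W}).

Lemma subspace_image f A : is_subspace A -> is_subspace (f @` A).
Proof.
move=> sA; apply/is_subspaceP; split.
  by exists 0; [exact: subspace0|rewrite linear0].
move=> a _ _ [u Au <-] [v Av <-]; exists (a *: u + v); first exact: subspaceZD.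
by rewrite linearP.
Qed.

Lemma subspace_preimage f A : is_subspace A -> is_subspace (f @^-1` A).
Proof.
move=> sA; apply/is_subspaceP; split; first by rewrite /= linear0; apply: subspace0.
by move=> a u v Au Av; rewrite /= linearP; apply: subspaceZD.
Qed.

Lemma subspace_null f : is_subspace (null_space f).
Proof. by apply: subspace_preimage; exact: subspace_set0. Qed.

Lemma image_cospan f A s : f @` cospan A s `<=` cospan (f @` A) (map f s).
Proof.
move=> _ [x sx <-]; elim: s x sx => [x Ax|v s IH x [c sx]] /=; first by exists x.
by exists c; rewrite -linearZ -linearB; apply: IH.
Qed.

Lemma fin_dim_image_quotient f A U s : is_subspace U ->
  A `<=` null_space f -> U `<=` cospan A s -> fin_dim (f @` U).
Proof.
move=> sU Af Us; split; first exact: subspace_image.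
exists (map f s) => _ [x /Us sx <-].
apply: (@cospan_sub _ _ (f @` A)); first by move=> _ [a /Af a0 <-].
by apply: image_cospan; exists x.
Qed.

End Images.

Section SurjectiveInjective.
Context {K : numFieldType} {V : normedModType K}.

(** The vectors of U killed by some iterate of f form a finite dimensional subspace,
so one iterate f^k kills them all.  A vector x of U in the kernel of f is f^k y
for some y in U; then f^(k+1) y = 0, hence x = f^k y = 0. *)
Lemma fin_dim_surj_inj (f : {linear V -> V}) (U : set V) : fin_dim U ->
  f @` U = U -> forall x, U x -> f x = 0 -> x = 0.
Proof.
move=> fU fUE x Ux fx0; have sU : is_subspace U by case: fU.
have iter_lin k a u v : iter k f (a *: u + v) = a *: iter k f u + iter k f v.
  by elim: k => //= k ->; rewrite linearP.
have iter0 k : iter k f 0 = 0 by elim: k => //= k ->; rewrite linear0.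
have iterK u k m : (k <= m)%N -> iter k f u = 0 -> iter m f u = 0.
  by move=> km ku; rewrite -(subnK km) iterD ku iter0.
pose N := U `&` [set y | exists k, iter k f y = 0].
have sN : is_subspace N.
  apply: subspaceI => //; apply/is_subspaceP; split; first by exists 0%N.
  move=> a u v [k ku] [m mv]; exists (maxn k m).
  rewrite iter_lin (iterK _ _ _ (leq_maxl k m) ku) (iterK _ _ _ (leq_maxr k m) mv).
  by rewrite scaler0 addr0.
have [s NE] := fin_dimE (fin_dim_sub sN (@subIsetl _ _ _) fU).
have [k Nk] : exists k, forall y, N y -> iter k f y = 0.
  suff [|k sk] : cospan [set 0] s `<=` N ->
      exists k, forall y, cospan [set 0] s y -> iter k f y = 0.
    by rewrite -NE.
    by exists k; rewrite NE.
  elim: s {NE} => [_|v s IH sN'].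
    by exists 0%N => y ->.
  have [|k sk] := IH.
    by move=> y sy; apply: (sN' y); exists 0; rewrite scale0r subr0.
  have [_ [m mv]] : N v by apply: (sN' v); exact: (@cospan_mem _ _ (v :: s) 0%N).
  exists (maxn k m) => y [c /sk ky].
  rewrite -[y](subrK (c *: v)) addrC iter_lin (iterK _ _ _ (leq_maxr k m) mv).
  by rewrite (iterK _ _ _ (leq_maxl k m) ky) scaler0 addr0.
have [y Uy yx] : exists2 y, U y & iter k f y = x.
  elim: k x Ux {fx0 Nk} => [x Ux|k IH x]; first by exists x.
  rewrite -{1}fUE => -[z /IH[y Uy <-] <-].
  by exists y.
rewrite -yx; apply: Nk; split=> //; exists k.+1.
by rewrite iterS yx.
Qed.

End SurjectiveInjective.

(** * The Hahn-Banach theorem and separation by functionals *)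

(** Real-linearity is expressed through an embedding [iota] of the reals into the
scalar field, so that one statement covers real and complex spaces.  Partial
functionals are represented by their graphs, ordered by inclusion. *)
Section HahnBanach.
Context {R : realType} {K : numFieldType} (iota : {rmorphism R -> K}).
Context {V : lmodType K} (p : V -> R).
Hypothesis pD : forall u v, p (u + v) <= p u + p v.
Hypothesis pZ : forall a u, 0 <= a -> p (iota a *: u) = a * p u.
Implicit Types G : set (V * R).

Let p0 : p 0 = 0.
Proof. by rewrite -(scale0r 0) -(rmorph0 iota) pZ // mul0r. Qed.

Definition linear_graph G := forall a u r v s,
  G (u, r) -> G (v, s) -> G (iota a *: u + v, a * r + s).

Definition dominated_graph G := forall u r, G (u, r) -> r <= p u.

(** The value g at v must satisfy r - p (u - v) <= g <= p (u + v) - r for all (u, r)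
in the graph.  Subadditivity of p makes each lower bound at most each upper
bound, and g is the supremum of the former. *)
Lemma graph_extension G v : linear_graph G -> dominated_graph G -> G (0, 0) ->
  exists H, [/\ G `<=` H, linear_graph H, dominated_graph H & exists r, H (v, r)].
Proof.
move=> linG domG G0.
pose E := [set a.2 - p (a.1 - v) | a in G].
have ubE b : G b -> ubound E (p (b.1 + v) - b.2).
  case: b => w s /= Gws _ [[u r] /= Gur <-].
  have Guw := linG 1 _ _ _ _ Gur Gws.
  have := domG _ _ Guw; rewrite rmorph1 scale1r mul1r => h.
  (* (u - v) + (w + v) = u + w compares the two bounds *)
  have := pD (u - v) (w + v).
  have -> : u - v + (w + v) = u + w by rewrite addrCA addrNK addrC addrC.
  lra.
pose g := sup E.
have Ene : E !=set0 by exists (0 - p (0 - v)); exists (0, 0).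
have Eub : has_ubound E by exists (p (0 + v) - 0); exact: (ubE (0, 0)).
have gE u r : G (u, r) -> r - p (u - v) <= g.
  by move=> Gur; apply: ub_le_sup => //; exists (u, r).
have Eg u r : G (u, r) -> g <= p (u + v) - r.
  by move=> Gur; apply: ge_sup => //; exact: (ubE (u, r)).
have scaleG t u r : G (u, r) -> G (iota t *: u, t * r).
  by move=> /(linG t)/(_ G0); rewrite !addr0.
exists [set a | exists t u r, [/\ G (u, r) & a = (u + iota t *: v, r + t * g)]].
split.
- move=> [u r] Gur; exists 0, u, r; split=> //.
  by rewrite rmorph0 scale0r addr0 mul0r addr0.
- move=> a _ _ _ _ [t [u [r [Gur [-> ->]]]]] [t' [u' [r' [Gur' [-> ->]]]]].
  exists (a * t + t'), (iota a *: u + u'), (a * r + r'); split; first exact: linG.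
  congr (_, _); last by ring.
  by rewrite rmorphD rmorphM scalerDr scalerDl scalerA addrACA.
- move=> _ _ [t [u [r [Gur [-> ->]]]]].
  have iK s : s != 0 -> iota s *: (iota s^-1 *: u) = u.
    by move=> s0; rewrite scalerA -rmorphM divff // rmorph1 scale1r.
  case: (ltgtP t 0) => [t0|t0|->]; last first.
  + by rewrite rmorph0 scale0r addr0 mul0r addr0; exact: domG.
  + have := Eg _ _ (scaleG t^-1 _ _ Gur).
    rewrite -(ler_pM2l t0) mulrBr -(pZ _ (ltW t0)) scalerDr iK ?gt_eqF //.
    by rewrite mulVKf ?gt_eqF //; lra.
  + have s0 : 0 < - t by rewrite oppr_gt0.
    have := gE _ _ (scaleG (- t)^-1 _ _ Gur).
    rewrite -(ler_pM2l s0) mulrBr -(pZ _ (ltW s0)) scalerBr iK ?gt_eqF //.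
    by rewrite mulVKf ?gt_eqF // rmorphN scaleNr opprK; lra.
- exists g, 1, 0, 0; split=> //.
  by rewrite rmorph1 scale1r !add0r mul1r.
Qed.

Lemma hahn_banach x : exists phi : V -> R,
  [/\ forall a u v, phi (iota a *: u + v) = a * phi u + phi v,
      forall v, phi v <= p v & phi x = p x].
Proof.
pose L := [set (iota t *: x, t * p x) | t in [set: R]].
have linL : linear_graph L.
  move=> a _ _ _ _ [t _ [<- <-]] [s _ [<- <-]].
  exists (a * t + s) => //.
  by rewrite rmorphD rmorphM scalerDl scalerA; congr (_, _); ring.
have domL : dominated_graph L.
  move=> _ _ [t _ [<- <-]]; have [t0|t0] := leP 0 t; first by rewrite pZ.
  have := pD (iota t *: x) (iota (- t) *: x).
  rewrite (@pZ (- t)); last by rewrite oppr_ge0 ltW.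
  rewrite rmorphN scaleNr subrr p0.
  lra.
(* The empty set satisfies P: unions of empty chains have to be admitted. *)
pose P G := [/\ linear_graph G, dominated_graph G & G !=set0 -> L `<=` G].
have [G [[linG domG LG] maxG]] : exists G, P G /\ forall H, G `<` H -> ~ P H.
  apply: Zorn_bigcup => F FP totF; split.
  - move=> a u r v s [G FG Gur] [H FH Hvs].
    have [GH|HG] := totF _ _ FG FH.
      by exists H => //; have [linH _ _] := FP _ FH; exact: linH (GH _ Gur) Hvs.
    by exists G => //; have [linG _ _] := FP _ FG; exact: linG Gur (HG _ Hvs).
  - by move=> u r [G /FP[_ domG _]]; exact: domG.
  - move=> [a [G FG Ga]] b Lb; exists G => //.
    by have [_ _] := FP _ FG; apply=> //; exists a.
have {}LG : L `<=` G.
  apply: LG; apply/set0P/eqP => G0; apply: (maxG L); last by split=> // _ a.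
  rewrite G0; split=> // /(_ (0, 0)); apply.
  by exists 0; rewrite ?rmorph0 ?scale0r ?mul0r.
have G0 : G (0, 0) by apply: LG; exists 0; rewrite ?rmorph0 ?scale0r ?mul0r.
have totG v : exists r, G (v, r).
  have [H [GH linH domH [r Hr]]] := graph_extension v linG domG G0.
  exists r; apply: contrapT => nGr; apply: (maxG H).
    by split=> // HG; apply: nGr; exact: HG.
  by split=> // _; exact: subset_trans LG GH.
have funG v r s : G (v, r) -> G (v, s) -> r = s.
  have half a b : G (v, a) -> G (v, b) -> a <= b.
    move=> Ga Gb; have := linG (-1) _ _ _ _ Gb Ga.
    by rewrite rmorphN1 scaleN1r addNr => /domG; rewrite p0; lra.
  by move=> Gr Gs; apply/eqP; rewrite eq_le !half.
have [phi Gphi] := choice totG.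
exists phi; split=> [a u v|v|].
- by apply: funG (Gphi _) _; apply: linG.
- exact: domG.
- apply: funG (Gphi _) _; apply: LG; exists 1 => //.
  by rewrite rmorph1 scale1r mul1r.
Qed.

End HahnBanach.

Definition functionals_separate {K : numFieldType} (V : normedModType K) :=
  forall x : V, x != 0 -> exists f : {linear V -> K^o}, continuous f /\ f x = 1.

Lemma bounded_functional_continuous {K : numFieldType} {V W : normedModType K}
    (f : {linear V -> W}) (M : K) : M \is Num.real ->
  (forall v, `|f v| <= M * `|v|) -> continuous f.
Proof.
move=> Mr fM; apply: bounded_linear_continuous; apply/linear_boundedP.
by exists M; split=> // r Mr' x; apply: le_trans (fM x) _; rewrite ler_wpM2r // ltW.
Qed.

(** Normalizes a bounded functional by its value at x. *)
Lemma bounded_functional_separates {K : numFieldType} {V : normedModType K}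
    (h : V -> K) (M : K) (x : V) : M \is Num.real ->
  (forall a u v, h (a *: u + v) = a * h u + h v) ->
  (forall v, `|h v| <= M * `|v|) -> h x != 0 ->
  exists f : {linear V -> K^o}, continuous f /\ f x = 1.
Proof.
move=> Mr hlin hM hx0; pose f v : K^o := (h x)^-1 * h v.
have flin : linear f.
  by move=> a u v; rewrite /f hlin mulrDr mulrCA.
pose F : {linear V -> K^o} := HB.pack f (GRing.isLinear.Build K V K^o *:%R f flin).
exists F; split; last exact: mulVf.
apply: (@bounded_functional_continuous _ _ _ F (`|(h x)^-1| * M)).
  by rewrite realM.
by move=> v; rewrite normrM -mulrA ler_wpM2l.
Qed.

Lemma functionals_separate_real (R : realType) (V : normedModType R) :
  functionals_separate V.
Proof.
move=> x x0.
have pD (u v : V) : `|u + v| <= `|u| + `|v| := ler_normD u v.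
have pZ (a : R) (u : V) : 0 <= a ->
    `|(idfun : {rmorphism R -> R}) a *: u| = a * `|u|.
  by move=> a0; rewrite normrZ ger0_norm.
have [phi [philin phip phix]] := hahn_banach pD pZ x.
have phiN v : phi (- v) = - phi v.
  have := philin (-1) v 0; rewrite /= addr0 scaleN1r => ->.
  have := philin 1 0 0; rewrite /= scale1r addr0 mul1r; lra.
apply: (@bounded_functional_separates _ _ phi 1) => //; last first.
- by rewrite phix normr_eq0.
- move=> v; rewrite mul1r ler_norml phip andbT.
  by have := phip (- v); rewrite phiN normrN; lra.
Qed.

Lemma functionals_separate_complex (R : realType) (V : normedModType R[i]) :
  functionals_separate V.
Proof.
move=> x x0.
pose p (v : V) : R := complex.Re `|v|.
have pE v : `|v| = (p v)%:C%C.
  have := ger0_Im (normr_ge0 v); rewrite /p; case: `|v| => a b /= ->.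
  by [].
have pD (u v : V) : p (u + v) <= p u + p v.
  by have := ler_normD u v; rewrite !pE -rmorphD lecR.
pose io : {rmorphism R -> R[i]} := real_complex R.
have pZ (a : R) (u : V) : 0 <= a -> p (io a *: u) = a * p u.
  move=> a0; apply: complexI; rewrite -pE normrZ ger0_norm; last by rewrite lecR.
  by rewrite pE -rmorphM.
have [phi [philin phip phix]] := hahn_banach pD pZ x.
have phi0 : phi 0 = 0.
  by have := philin 1 0 0; rewrite rmorph1 scale1r addr0 mul1r; lra.
have phiZ a u : phi (io a *: u) = a * phi u.
  by have := philin a u 0; rewrite !addr0 phi0 addr0.
have phiD u v : phi (u + v) = phi u + phi v.
  by have := philin 1 u v; rewrite rmorph1 scale1r mul1r.
have phiN v : phi (- v) = - phi v.
  by have := phiZ (-1) v; rewrite rmorphN1 scaleN1r mulN1r.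
have phiB v : `|phi v| <= p v.
  rewrite ler_norml phip andbT.
  by have := phip (- v); rewrite phiN {1}/p normrN -/(p v); lra.
(* The complex-linear functional whose real part is phi. *)
pose h v : R[i] := (phi v)%:C%C - 'i%C * (phi ('i%C *: v))%:C%C.
apply: (@bounded_functional_separates _ _ h 2%:R) => //.
- move=> [a b] u v.
  have cE : Complex a b = io a + io b * 'i%C.
    by rewrite /io /=; simpc.
  have E1 : phi (Complex a b *: u + v) = a * phi u + b * phi ('i%C *: u) + phi v.
    by rewrite cE phiD scalerDl phiD -scalerA !phiZ.
  have E2 : phi ('i%C *: (Complex a b *: u + v))
      = a * phi ('i%C *: u) - b * phi u + phi ('i%C *: v).
    rewrite cE scalerDr phiD; congr (_ + _).
    rewrite scalerA mulrDr [_ * io a]mulrC [io b * _]mulrC mulrA.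
    rewrite -[X in X * io b]expr2 sqr_i mulN1r -rmorphN scalerDl phiD -scalerA !phiZ.
    by rewrite mulNr.
  rewrite /h E1 E2; simpc.
  by congr (Complex _ _); ring.
- move=> v; apply: le_trans (ler_normB _ _) _.
  have i1 : `|'i%C : R[i]| = 1.
    by rewrite normc_def /= expr0n /= add0r expr1n sqrtr1.
  rewrite normrM i1 mul1r mulr_natl mulr2n.
  have nC (r : R) : `|r%:C%C : R[i]| = (`|r|)%:C%C.
    by rewrite normc_def /= expr0n /= addr0 sqrtr_sqr.
  rewrite !nC pE -!rmorphD lecR lerD //.
  apply: le_trans (phiB _) _.
  by rewrite /p normrZ i1 mul1r.
- apply: contra x0 => /eqP; rewrite /h; simpc => -[+ _].
  by rewrite phix => h0; rewrite -normr_eq0 pE h0.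
Qed.

Lemma scalar_field_functionals_separate (R : realType) (K : numFieldType) :
  scalar_field R K -> forall V : normedModType K, functionals_separate V.
Proof.
case=> V; [exact: functionals_separate_real|exact: functionals_separate_complex].
Qed.

(** * Closed subspaces and isomorphisms of Banach spaces *)

Section Closedness.
Context {K : numFieldType} {V W : normedModType K}.

Lemma closed_preimage (f : V -> W) A : continuous f -> closed A -> closed (f @^-1` A).
Proof. by move=> /continuous_closedP; apply. Qed.

Lemma closed_singleton (x : W) : closed [set x].
Proof.
apply: accessible_closed_set1; apply: hausdorff_accessible.
exact: norm_hausdorff.
Qed.

Lemma closed_kernel (f : V -> W) : continuous f -> closed [set x | f x = 0].
Proof. move=> cf; rewrite (_ : [set x | f x = 0] = f @^-1` [set 0]) //.
exact: (closed_preimage cf (@closed_singleton 0)). Qed.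

Lemma closed_null (f : {linear V -> W}) : continuous f -> closed (null_space f).
Proof. exact: closed_kernel. Qed.

End Closedness.

Section ClosedFixed.
Context {K : numFieldType} {V : normedModType K}.

Lemma closed_fixed (f : V -> V) : continuous f -> closed [set x | f x = x].
Proof.
move=> cf; have -> : [set x | f x = x] = [set x | f x - x = 0].
  by apply/seteqP; split=> x /= /eqP; rewrite ?subr_eq0 => /eqP // ->; rewrite subrr.
by apply: closed_kernel => x; apply: cvgB; [exact: cf|exact: cvg_id].
Qed.

End ClosedFixed.

(** Induction on a spanning list v :: s.  If L inverts T on the span of s, then
u = v - L (T v) is the defect of v; a functional g with g (T u) = 1, composed
with the map w |-> w - T (L w), vanishes on T (span s) and is 1 at T v.  The
corrected inverse is w |-> L w + g (w - T (L w)) u. *)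
Lemma fin_dim_left_inverse {K : numFieldType} {V W : normedModType K}
    (T : {linear V -> W}) (F : set V) : functionals_separate W -> continuous T ->
  fin_dim F -> (forall x, F x -> T x = 0 -> x = 0) ->
  exists L : {linear W -> V},
    [/\ continuous L, forall w, F (L w) & forall x, F x -> L (T x) = x].
Proof.
move=> sepW cT fF; have [s ->] := fin_dimE fF; move=> {F fF}.
elim: s => [_|v s IH injT].
  exists (\0 : {linear W -> V}); split=> [|w//|x ->]; last by [].
  by move=> w; exact: cvg_cst.
have ss : is_subspace (cospan [set 0] s).
  by apply: subspace_cospan; exact: subspace_set0.
have sub x : cospan [set 0] s x -> cospan [set 0] (v :: s) x.
  by move=> sx; exists 0; rewrite scale0r subr0.
have [|L [cL sL LT]] := IH; first by move=> x /sub; exact: injT.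
have [sv|nsv] := pselect (cospan [set 0] s v).
  exists L; split=> // [w|x [c sx]]; first exact/sub/sL.
  by apply: LT; rewrite -[x](subrK (c *: v)); apply: subspaceD => //; apply: subspaceZ.
pose u := v - L (T v).
have u0 : T u != 0.
  apply/eqP => Tu0; apply: nsv.
  have : u = 0.
    apply: injT => //; exists 1; rewrite scale1r /u addrAC subrr add0r.
    exact: subspaceN.
  by move/eqP; rewrite subr_eq0 => /eqP ->.
have [g [cg gu]] := sepW _ u0.
pose f w : K := g (w - T (L w)).
have fP a w w' : f (a *: w + w') = a * f w + f w'.
  by rewrite /f (linearP L) (linearP T) opprD addrACA -scalerBr linearP.
have fs x : cospan [set 0] s x -> f (T x) = 0.
  by move=> sx; rewrite /f LT // subrr linear0.
have fv : f (T v) = 1 by rewrite /f -linearB.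
pose L' w := L w + f w *: u.
have L'lin : linear L'.
  move=> a w w'; rewrite /L' linearP fP scalerDl [_ *: (L w + _)]scalerDr scalerA.
  by rewrite addrACA.
exists (HB.pack L' (GRing.isLinear.Build K W V *:%R L' L'lin) : {linear W -> V}).
split=> [|w|x [c sx]] /=.
- move=> w; apply: cvgD; first exact: cL.
  apply: cvgZr_tmp; apply: (@cvg_comp _ _ _ (fun w => w - T (L w)) g); last exact: cg.
  apply: cvgB; first exact: cvg_id.
  apply: (@cvg_comp _ _ _ L T); [exact: cL|exact: cT].
- exists (f w); rewrite /L' /u scalerBr addrA addrAC addrK.
  by apply: subspaceB => //; apply: subspaceZ.
- have -> : x = c *: v + (x - c *: v) by rewrite addrC subrK.
  move: (x - c *: v) sx => x' sx'.
  rewrite /L' (linearP T) (linearP L) fP (fs x') // fv mulr1 addr0 (LT x') //.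
  by rewrite addrAC -scalerDr /u [L _ + _]addrC subrK.
Qed.

Lemma fin_dim_closed {K : numFieldType} {V : normedModType K} (F : set V) :
  functionals_separate V -> fin_dim F -> closed F.
Proof.
move=> sepV fF.
have [||L [cL FL LK]] := fin_dim_left_inverse (T := idfun) sepV _ fF => //.
  by move=> x; exact: cvg_id.
have -> : F = [set x | L x = x].
  by apply/seteqP; split=> [x /LK//|x /= <-].
exact: closed_fixed.
Qed.

(** The image is cut out of W by the closed conditions S (g y) = y and g y in A. *)
Lemma left_inverse_image_closed {K : numFieldType} {V W : normedModType K}
    (S : {linear V -> W}) (A : set V) (g : W -> V) :
  continuous S -> closed A -> continuous g -> (forall x, A x -> g (S x) = x) ->
  closed (S @` A).
Proof.
move=> cS cA cg gS.
have -> : S @` A = [set y | S (g y) = y] `&` g @^-1` A.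
  apply/seteqP; split=> [_ [x Ax <-]|y [/= Sgy Ay]]; first by rewrite /= gS.
  by exists (g y).
apply: closedI; last exact: closed_preimage.
by apply: (@closed_fixed _ _ (S \o g)) => y; apply: continuous_comp; [exact: cg|exact: cS].
Qed.

Lemma left_inverse_banach_iso {K : numFieldType} {V W : normedModType K}
    (S : {linear V -> W}) (A : set V) (g : W -> V) :
  continuous S -> is_subspace A -> closed A -> continuous g ->
  (forall x, A x -> g (S x) = x) -> banach_iso S A (S @` A).
Proof.
move=> cS sA cA cg gS; split=> //.
- split; first exact: subspace_image.
  exact: left_inverse_image_closed gS.
- split=> // x y.
  by rewrite !inE => Ax Ay Sxy; rewrite -[x]gS // Sxy gS.
- exact: continuous_subspaceT.
- by exists g => //; exact: continuous_subspaceT.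
Qed.

Lemma fin_dim_banach_iso {K : numFieldType} {V W : normedModType K}
    (S : {linear V -> W}) (A : set V) :
  functionals_separate V -> functionals_separate W -> continuous S ->
  fin_dim A -> (forall x, A x -> S x = 0 -> x = 0) -> banach_iso S A (S @` A).
Proof.
move=> sepV sepW cS fA injS; have [sA _] := fA.
have [g [cg _ gS]] := fin_dim_left_inverse sepW cS fA injS.
by apply: left_inverse_banach_iso cg gS => //; exact: fin_dim_closed.
Qed.

Lemma subspace_restricted_preimage {K : numFieldType} {V W : normedModType K}
    (S : {linear V -> W}) (U : set V) (P : set W) :
  is_subspace U -> is_subspace P -> is_subspace [set x | U x /\ P (S x)].
Proof. by move=> sU sP; apply: (subspaceI sU); exact: subspace_preimage. Qed.

Lemma splits_preimage {K : numFieldType} {V W : normedModType K}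
    (S : {linear V -> W}) (U : set V) (P Q : set W) : is_subspace U ->
  (forall x, U x -> S x = 0 -> x = 0) -> splits (S @` U) P Q ->
  splits U [set x | U x /\ P (S x)] [set x | U x /\ Q (S x)].
Proof.
move=> sU Sinj [PU QU PQ PQ0]; split=> [x []//|x []//|x Ux|x [Ux Px] [_ Qx]].
  have [y [z [Py Qz Sx]]] := PQ _ (imageP S Ux).
  have [a Ua ay] := PU _ Py; have [b Ub bz] := QU _ Qz.
  exists a, b; split; [by rewrite /= ay|by rewrite /= bz|].
  apply/eqP; rewrite -subr_eq0; apply/eqP; apply: Sinj.
    by apply: subspaceB => //; exact: subspaceD.
  by rewrite linearB linearD ay bz Sx subrr.
by apply: Sinj => //; exact: PQ0.
Qed.

Lemma image_restricted_preimage {K : numFieldType} {V W : normedModType K}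
    (S : {linear V -> W}) (U : set V) (P : set W) : P `<=` S @` U ->
  S @` [set x | U x /\ P (S x)] = P.
Proof.
move=> PU; apply/seteqP; split=> [_ [x [_ Px] <-]//|y /[dup] Py /PU[x Ux Sx]].
by exists x => //=; rewrite Sx.
Qed.

Lemma restricted_preimage_banach_iso {K : numFieldType} {V W : normedModType K}
    (S : {linear V -> W}) (U : set V) (P : set W) (g : W -> V) :
  continuous S -> is_subspace U -> closed U ->
  continuous g -> (forall x, U x -> g (S x) = x) ->
  is_subspace P -> closed P -> P `<=` S @` U ->
  banach_iso S [set x | U x /\ P (S x)] P.
Proof.
move=> cS sU cU cg gS sP cP PU.
rewrite -[Q in banach_iso _ _ Q](image_restricted_preimage PU).
apply: left_inverse_banach_iso cg _ => // [||x [Ux _]].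
- exact: subspace_restricted_preimage.
- by apply: closedI => //; exact: closed_preimage.
- exact: gS.
Qed.

(** * One level of an adapted system *)

Section StageLift.
Context {K : numFieldType} {V W : normedModType K} (T : {linear V -> W}).

(** The relations of an adapted system that concern one level of one chain.  For the
chain of S, U and U1 are R_S n and R_S (n+1), A is Rt_S n and Z is Y2; the map T
is the one applied next.  The roles are exchanged for the chain of T. *)
Definition stage (U U1 A Z : set V) :=
  [/\ is_subspace A /\ closed A, splits U U1 A,
      splits A (A `&` null_space T) (A `&` Z) &
      splits U (U `&` null_space T) (U `&` Z)].

(** The inductive step.  Let H be a finite dimensional complement of U & N in U and
M = U1 & N, where N is the null space of T.  The new A is the sum of the
lift B of A' into H and of a complement of M in U & N; the new Z is Z + B.
Writing L for a continuous inverse of T on H, and P for a continuous projection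
onto M, every y in U has components L (T y) in H and y - L (T y) in N, so that A
is the closed set of all y in U with T y in A' and P (y - L (T y)) = 0. *)
Lemma stage_lift (U U1 Z : set V) (A' : set W) (s : seq V) :
  functionals_separate V -> functionals_separate W -> continuous T ->
  is_subspace U -> closed U -> U `<=` cospan (null_space T) s ->
  U1 `<=` U -> fin_dim U1 ->
  is_subspace A' -> closed A' -> splits (T @` U) (T @` U1) A' ->
  is_subspace Z -> Z `<=` U1 -> splits U1 (U1 `&` null_space T) Z ->
  exists A Z1, [/\ stage U U1 A Z1, T @` A = A',
    is_subspace Z1, Z1 `<=` U & U1 `&` Z1 = Z].
Proof.
set N := null_space T => sepV sepW cT sU cU UN U1U fU1 sA' cA' [_ A'U UA' A'0].
move=> sZ ZU1 [_ _ U1Z Z0].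
have sU1 : is_subspace U1 by case: fU1.
have sN : is_subspace N := subspace_null T.
have [t] := exists_complement sN sU UN.
have := fin_dim_cospan t; set H := cospan _ t => fH [_ HU UH H0].
have sH : is_subspace H by case: fH.
have Hinj x : H x -> T x = 0 -> x = 0 
  by move=> Hx Tx; apply: H0 => //; split; [exact: HU|].
have [L [cL HL LT]] := fin_dim_left_inverse sepW cT fH Hinj.
have [|||P [cP PN PK]] := @fin_dim_left_inverse _ _ _ idfun (U1 `&` N) sepV.
- by move=> x; exact: cvg_id.
- by apply: fin_dim_sub fU1; [exact: subspaceI|].
- by [].
have {}PK x : (U1 `&` N) x -> P x = x by exact: PK.
have TLT y : U y -> T (L (T y)) = T y.
  move=> /UH[m [w [[_ Tm] Hw ->]]].
  by rewrite linearD Tm add0r LT.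
pose A := U `&` [set y | A' (T y) /\ P (y - L (T y)) = 0].
pose B := H `&` T @^-1` A'.
have sB : is_subspace B by apply: subspaceI => //; apply: subspace_preimage.
have sA : is_subspace A.
  apply: subspaceI => //; apply/is_subspaceP; split.
    by rewrite /= !linear0 addr0 linear0; split=> //; exact: subspace0.
  move=> a u v [A'u Pu] [A'v Pv]; split; first by rewrite linearP; apply: subspaceZD.
  by rewrite (linearP T) (linearP L) opprD addrACA -scalerBr linearP Pu Pv scaler0 addr0.
have A_lift b : B b -> A b.
  by move=> [Hb A'b]; split; [exact: HU|split=> //; rewrite LT // subrr linear0].
have U1A' x : U1 x -> A' (T x) -> T x = 0.
  by move=> U1x A'x; apply: A'0 => //; exists x.
have liftA' a : A' a -> B (L a) /\ T (L a) = a.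
  move=> A'a; have [y Uy ya] := A'U _ A'a.
  have TLa : T (L a) = a by rewrite -ya TLT.
  by split=> //; split; [exact: HL|rewrite /= TLa].
exists A, (add_set Z B).
have sZ1 := subspace_add sZ sB.
have UsplitZ1 : splits U (U `&` N) (U `&` add_set Z B).
  split=> [x []//|x []//|u Uu|].
  - have [_ [a [[r U1r <-] A'a Tua]]] := UA' (T u) (imageP _ Uu).
    have [BLa TLa] := liftA' _ A'a.
    have [n [z [[U1n Nn] Zz rE]]] := U1Z _ U1r.
    have ULa : U (L a) by exact/HU/HL.
    have Uz : U z by exact/U1U/ZU1.
    exists (u - (z + L a)), (z + L a); split; last by rewrite subrK.
    + split; first by apply: subspaceB => //; apply: subspaceD.
      by rewrite /N /null_space /= linearB linearD TLa Tua rE linearD Nn add0r subrr.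
    + by split; [exact: subspaceD|exists z => //; exists (L a)].
  - move=> x [Ux Nx] [_ [z Zz [b [Hb A'b] xE]]].
    have zb : T z + T b = 0 by rewrite -linearD xE.
    have b0 : b = 0.
      apply: Hinj => //; apply: A'0 => //; exists (- z).
        by apply: subspaceN => //; exact: ZU1.
      by rewrite linearN; apply/eqP; rewrite eqr_oppLR -addr_eq0 zb.
    rewrite -xE b0 addr0; apply: Z0 => //; split; first exact: ZU1.
    by rewrite /N /null_space /=; move: zb; rewrite b0 linear0 addr0.
have AsubU : A `<=` U by move=> x [].
split=> //; last first.
- apply/seteqP; split=> [x [U1x [z Zz [b [Hb A'b] xE]]]|z Zz]; last first.
    by split; [exact: ZU1|exact: sub_addl].
  have U1b : U1 b.
    by have -> : b = x - z; [rewrite -xE addrC addKr|apply: subspaceB => //; exact: ZU1].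
  by rewrite -xE (Hinj b) ?addr0 //; exact: U1A'.
- move=> _ [z Zz [b [Hb _] <-]]; apply: subspaceD => //; first exact/U1U/ZU1.
  exact: HU.
- apply/seteqP; split=> [_ [x [_ [A'x _]] <-]//|a A'a].
  by have [BLa TLa] := liftA' _ A'a; exists (L a) => //; exact: A_lift.
split=> //.
- split=> //; apply: closedI => //; apply: closedI; first exact: closed_preimage.
  apply: closed_kernel => y.
  apply: (@cvg_comp _ _ _ (fun y => y - L (T y)) P); last exact: cP.
  apply: cvgB; first exact: cvg_id.
  by apply: (@cvg_comp _ _ _ T L); [exact: cT|exact: cL].
- split=> // [u Uu|x U1x [Ux [A'x Px]]]; last first.
    have Tx0 := U1A' _ U1x A'x.
    by move: Px; rewrite Tx0 linear0 subr0 PK.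
  have [_ [a [[r U1r <-] A'a Tua]]] := UA' (T u) (imageP _ Uu).
  have [BLa TLa] := liftA' _ A'a.
  pose m := u - r - L a.
  have Nm : N m by rewrite /N /null_space /m /= !linearB TLa Tua addrAC addrK subrr.
  have Um : U m.
    apply: subspaceB => //; last by apply: HU; exact: HL.
    by apply: subspaceB => //; exact: U1U.
  have [U1P NP] := PN m.
  exists (r + P m), (L a + (m - P m)); split.
  + exact: subspaceD.
  + apply: subspaceD => //; first exact: A_lift.
    split; first by apply: subspaceB => //; exact: U1U.
    have TmP : T (m - P m) = 0 by rewrite linearB Nm NP subrr.
    rewrite /= TmP.
    split; first exact: subspace0.
    by rewrite linear0 subr0 linearB (PK (P m)) // subrr.
  + rewrite addrACA [P m + _]addrC subrK /m -addrA [L a + _]addrC subrK.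
    by rewrite addrC subrK.
- split=> [x []//|x []//|y Ay|x [Ax Nx] [_ Zx]]; last first.
    by have [_ _ _] := UsplitZ1; apply; split=> //; exact: AsubU.
  have [Uy [A'y Py]] := Ay.
  have [BLy TLy] := liftA' _ A'y.
  exists (y - L (T y)), (L (T y)); split; last by rewrite subrK.
  + split; first by apply: subspaceB => //; exact: A_lift.
    by rewrite /N /null_space /= linearB TLy subrr.
  + by split; [exact: A_lift|apply: sub_addr].
Qed.

End StageLift.

(** * The alternating images *)

Section AlternatingImages.
Context {K : numFieldType} {X Y : normedModType K}.
Variables (S : {linear X -> Y}) (T : {linear Y -> X}).

(** The definitions are symmetric in (X, S) and (Y, T); every fact on [R_S] therefore
gives one on [R_T]. *)
Lemma alt_sym A B n :
  altS T S B A n = altT S T A B n /\ altT T S B A n = altS S T A B n.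
Proof. by elim: n => //= n [-> ->]. Qed.

Lemma R_sym n : R_S T S n = R_T S T n /\ R_T T S n = R_S S T n.
Proof. exact: alt_sym. Qed.

(** Reads the recursion from the inner end: a chain that starts at level 1 is a chain
that starts at level 2, preceded by one more term. *)
Lemma alt_shift A B n :
  altS S T A B n.+1 = altS S T (T @` B) (S @` A) n /\
  altT S T A B n.+1 = altT S T (T @` B) (S @` A) n.
Proof. by elim: n => // n [h1 h2]; split=> /=; [rewrite -h2|rewrite -h1]. Qed.

Lemma alt_set0 n : altS S T [set 0] [set 0] n = [set 0] /\
  altT S T [set 0] [set 0] n = [set 0].
Proof.
have im0 (V W : normedModType K) (f : {linear V -> W}) : f @` [set 0] = [set 0].
  by rewrite image_set1 linear0.
by elim: n => //= n [-> ->]; split; exact: im0.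
Qed.

Lemma subspace_alt A B n : is_subspace A -> is_subspace B ->
  is_subspace (altS S T A B n) /\ is_subspace (altT S T A B n).
Proof.
move=> sA sB; elim: n => //= n [hS hT].
by split; apply: subspace_image.
Qed.

Lemma subspace_R n : is_subspace (R_S S T n) /\ is_subspace (R_T S T n).
Proof. by apply: subspace_alt; exact: subspace_setT. Qed.

Lemma R_decr n : R_S S T n.+1 `<=` R_S S T n /\ R_T S T n.+1 `<=` R_T S T n.
Proof. by elim: n => // n [hS hT]; split; apply: image_subset. Qed.

Lemma R_S_le m n : (m <= n)%N -> R_S S T n `<=` R_S S T m.
Proof.
move/subnK <-; elim: (n - m)%N => // k IH.
by apply: subset_trans IH; have [] := R_decr (k + m).
Qed.

End AlternatingImages.

Lemma regular_fredholm_pair_sym {K : numFieldType} {X Y : normedModType K}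
    (S : {linear X -> Y}) (T : {linear Y -> X}) :
  regular_fredholm_pair S T -> regular_fredholm_pair T S.
Proof. by case=> ? ? [? ? ? ?] ? ?; split. Qed.

(** R_S 2 = S (R(T)) is finite dimensional since S vanishes on N(S) & R(T), which has
finite codimension in R(T). *)
Lemma R_S_fin_dim {K : numFieldType} {X Y : normedModType K}
    (S : {linear X -> Y}) (T : {linear Y -> X}) n :
  regular_fredholm_pair S T -> fin_dim (R_S S T n.+2).
Proof.
move=> [_ _ [_ fR _ _] _ _]; have [s Rs] := finite_dim_quotient_cospan fR.
have f2 : fin_dim (R_S S T 2).
  apply: (fin_dim_image_quotient _ _ Rs); last exact: subIsetl.
  by have [_] := subspace_R S T 1.
by apply: fin_dim_sub f2; [have [] := subspace_R S T n.+2|exact: R_S_le].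
Qed.

Lemma R_S_closed {K : numFieldType} {X Y : normedModType K}
    (S : {linear X -> Y}) (T : {linear Y -> X}) n :
  functionals_separate Y -> regular_fredholm_pair S T -> closed (R_S S T n.+1).
Proof.
move=> sepY rST; case: n => [|n]; last first.
  by apply: fin_dim_closed => //; exact: R_S_fin_dim.
have [cS _ _ [S' cS' SS'] _] := rST.
have -> : R_S S T 1 = [set y | (S \o S') y = y].
  by apply/seteqP; split=> [_ [x _ <-]|y /= <-] //=; exists (S' y).
by apply: closed_fixed => y; apply: continuous_comp; [exact: cS'|exact: cS].
Qed.

Lemma R_S_cospan {K : numFieldType} {X Y : normedModType K}
    (S : {linear X -> Y}) (T : {linear Y -> X}) :
  regular_fredholm_pair S T ->
  exists s, forall n, R_S S T n.+1 `<=` cospan (null_space T) s.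
Proof.
move=> [_ _ [_ _ _ fR] _ _]; have [s Rs] := finite_dim_quotient_cospan fR.
exists s => n; apply: (@subset_trans _ (R_S S T 1)); first exact: R_S_le.
apply: subset_trans Rs _; apply: cospan_sub; exact: subIsetl.
Qed.

(** * Relations between consecutive levels *)

Section Stages.
Context {K : numFieldType} {V W : normedModType K} (T : {linear V -> W}).
Implicit Types U A Z : set V.

(** Only the part of Z inside U matters at a given level, so the complement can grow
while the construction proceeds towards level 1. *)
Lemma stage_complement U U1 A M Z Z1 :
  U `<=` M -> M `&` Z1 = Z -> stage T U U1 A Z -> stage T U U1 A Z1.
Proof.
move=> UM <- [cA [U1U AU Us U0]].
by rewrite !setIA !(setIidl (subset_trans AU UM)) (setIidl UM).
Qed.

(** Decompose u in U along A and U1, and both components along N and Z: if u is in N,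
the Z-parts add up to an element of N & Z and vanish; if u is in Z, the N-parts
do. *)
Lemma stage_chain U U1 U2 A A1 Z : is_subspace U -> is_subspace Z ->
  stage T U U1 A Z -> stage T U1 U2 A1 Z ->
  splits (U `&` null_space T) (A `&` null_space T) (U1 `&` null_space T) /\
  splits (U `&` Z) (A `&` Z) (U1 `&` Z).
Proof.
set N := null_space T => sU sZ [_ [U1U AU Us U0] [_ _ As _] [_ _ _ UNZ]].
move=> [_ _ _ [_ _ U1s _]].
have sN : is_subspace N := subspace_null T.
have dec u : U u -> exists a b c d, [/\ (A `&` N) a, (A `&` Z) b, (U1 `&` N) c,
    (U1 `&` Z) d & u = (a + c) + (b + d)].
  move=> /Us[_ [_ [/U1s[c [d [Uc Ud ->]]] /As[a [b [Aa Ab ->]]] ->]]].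
  by exists a, b, c, d; split=> //; rewrite addrACA [c + a]addrC [d + b]addrC.
have key n z : U n -> N n -> U z -> Z z -> n = z -> n = 0.
  by move=> Un Nn Uz Zz nz; apply: UNZ => //; rewrite nz; split.
have sub m x : U1 m -> A x -> U (x + m).
  by move=> Um Ax; apply: subspaceD => //; [exact: AU|exact: U1U].
split; split.
- by apply: setSI.
- by apply: setSI.
- move=> u [Uu Nu].
  have [a [b [c [d [[Aa Na] [Ab Zb] [Uc Nc] [Ud Zd] uE]]]]] := dec u Uu.
  exists a, c; split=> //; apply/eqP; rewrite -subr_eq0; apply/eqP.
  apply: (key _ (b + d)); rewrite ?uE; last by rewrite addrC addKr.
  + by rewrite addrC addKr; apply: sub.
  + by rewrite -uE; apply: subspaceB => //; apply: subspaceD.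
  + exact: sub.
  + exact: subspaceD.
- by move=> x [Ax _] [Ux _]; exact: U0.
- by apply: setSI.
- by apply: setSI.
- move=> u [Uu Zu].
  have [a [b [c [d [[Aa Na] [Ab Zb] [Uc Nc] [Ud Zd] uE]]]]] := dec u Uu.
  exists b, d; split=> //; rewrite uE (key (a + c) (u - (b + d))) ?add0r //.
  + exact: sub.
  + exact: subspaceD.
  + by apply: subspaceB => //; exact: sub.
  + by apply: subspaceB => //; exact: subspaceD.
  + by rewrite uE addrK.
- by move=> x [Ax _] [Ux _]; exact: U0.
Qed.

Lemma splits_image U Z : is_subspace U -> splits U (U `&` null_space T) (U `&` Z) ->
  T @` (U `&` Z) = T @` U.
Proof.
move=> sU [_ _ Us _]; apply/seteqP; split; first by apply: image_subset; exact: subIsetl.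
move=> _ [u /Us[a [b [[_ Ta] Ub ->]]] <-]; exists b => //.
by rewrite linearD Ta add0r.
Qed.

End Stages.

(** * Construction of the levels from the deep end *)

Section AdaptedFrom.
Context {K : numFieldType} {X Y : normedModType K}.
Variables (S : {linear X -> Y}) (T : {linear Y -> X}).

(** All relations at the levels n, n+1, ... when A and A' start the chains of
complements at level n; for n = 1 these are the relations of an adapted system. *)
Definition adapted_from n (A Z : set Y) (A' Z' : set X) :=
  [/\ forall k, stage T (R_S S T (n + k)) (R_S S T (n + k).+1) (altS S T A' A k) Z,
      forall k, stage S (R_T S T (n + k)) (R_T S T (n + k).+1) (altT S T A' A k) Z',
      is_subspace Z /\ Z `<=` R_S S T n &
      is_subspace Z' /\ Z' `<=` R_T S T n].

Hypothesis sepX : functionals_separate X.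
Hypothesis sepY : functionals_separate Y.
Hypothesis rST : regular_fredholm_pair S T.

Lemma adapted_from_pred n A Z A' Z' : adapted_from n.+2 A Z A' Z' ->
  exists A1 Z1 A1' Z1', adapted_from n.+1 A1 Z1 A1' Z1'.
Proof.
move=> [hS hT [sZ ZR] [sZ' ZR']].
have rTS := regular_fredholm_pair_sym rST.
have [cS cT _ _ _] := rST.
have [s Rs] := R_S_cospan rST; have [s' Rs'] := R_S_cospan rTS.
have [[sA cA] splA _ splZ] := hS 0%N; have [[sA' cA'] splA' _ splZ'] := hT 0%N.
rewrite /= addn0 in sA cA splA splZ sA' cA' splA' splZ'.
rewrite (setIidr ZR) in splZ; rewrite (setIidr ZR') in splZ'.
have [A1 [Z1 [st1 TA1 sZ1 Z1R Z1E]]] :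
  exists A1 Z1, [/\ stage T (R_S S T n.+1) (R_S S T n.+2) A1 Z1, T @` A1 = A',
    is_subspace Z1, Z1 `<=` R_S S T n.+1 & R_S S T n.+2 `&` Z1 = Z].
  apply: (stage_lift sepY sepX cT _ _ (Rs n) _ _ sA' cA' splA' sZ ZR splZ).
  - by have [] := subspace_R S T n.+1.
  - exact: R_S_closed.
  - by have [] := R_decr S T n.+1.
  - exact: R_S_fin_dim.
have [A1' [Z1' [st1' SA1 sZ1' Z1R' Z1E']]] :
  exists A1 Z1, [/\ stage S (R_T S T n.+1) (R_T S T n.+2) A1 Z1, S @` A1 = A,
    is_subspace Z1, Z1 `<=` R_T S T n.+1 & R_T S T n.+2 `&` Z1 = Z'].
  have fT : fin_dim (R_T S T n.+2).
    by have [<- _] := R_sym S T n.+2; exact: R_S_fin_dim.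
  have Rs'n : R_T S T n.+1 `<=` cospan (null_space S) s'.
    by have [<- _] := R_sym S T n.+1; exact: Rs'.
  apply: (stage_lift sepX sepY cS _ _ Rs'n _ _ sA cA splA sZ' ZR' splZ').
  - by have [] := subspace_R S T n.+1.
  - by have [<- _] := R_sym S T n.+1; exact: R_S_closed.
  - by have [] := R_decr S T n.+1.
  - exact: fT.
exists A1, Z1, A1', Z1'; split=> // -[|k]; rewrite ?addn0 //.
- have [-> _] := alt_shift S T A1' A1 k; rewrite TA1 SA1.
  apply: (stage_complement _ Z1E); first by apply: R_S_le; rewrite addnS leq_addr.
  by rewrite addnS -addSn.
- have [_ ->] := alt_shift S T A1' A1 k; rewrite TA1 SA1.
  apply: (stage_complement _ Z1E'); last by rewrite addnS -addSn.
  have [<- _] := R_sym S T (n.+1 + k.+1); have [<- _] := R_sym S T n.+2.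
  by apply: R_S_le; rewrite addnS leq_addr.
Qed.

(** Beyond the level where both chains are constant the complements are zero and
Y2, X2 are the stable subspaces themselves. *)
Lemma adapted_from_stable J :
  (forall k, R_S S T (J + k) = R_S S T J) ->
  (forall k, R_T S T (J + k) = R_T S T J) ->
  R_S S T J `&` null_space T = [set 0] ->
  R_T S T J `&` null_space S = [set 0] ->
  adapted_from J [set 0] (R_S S T J) [set 0] (R_T S T J).
Proof.
move=> stS stT NT NS.
have [sS sT] := subspace_R S T J.
have base (V W : normedModType K) (f : {linear V -> W}) (U : set V) :
    is_subspace U -> U `&` null_space f = [set 0] -> stage f U U [set 0] U.
  move=> sU UN; split.
  - by split; [exact: subspace_set0|exact: closed_singleton].
  - exact: splits_set0r.
  - rewrite !setIidl; first by apply: splits_set0r; exact: subspace_set0.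
    + by move=> x ->; exact: subspace0.
    + by move=> x ->; apply: subspace0; exact: subspace_null.
  - by rewrite setIid UN; apply: splitsC; exact: splits_set0r.
split; last 2 first.
- by split=> // ?.
- by split=> // ?.
- by move=> k; have [-> _] := alt_set0 S T k; rewrite -addnS !stS; exact: base.
- by move=> k; have [_ ->] := alt_set0 S T k; rewrite -addnS !stT; exact: base.
Qed.

Lemma exists_adapted_from J : (1 <= J)%N ->
  (forall k, R_S S T (J + k) = R_S S T J) ->
  (forall k, R_T S T (J + k) = R_T S T J) ->
  R_S S T J `&` null_space T = [set 0] ->
  R_T S T J `&` null_space S = [set 0] ->
  exists A Z A' Z', adapted_from 1 A Z A' Z'.
Proof.
case: J => // J _ stS stT NT NS.
suff H d : (d <= J)%N -> exists A Z A' Z', adapted_from (J - d).+1 A Z A' Z'.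
  by have := H J; rewrite subnn; apply.
elim: d => [_|d IH dJ].
  rewrite subn0; exists [set 0], (R_S S T J.+1), [set 0], (R_T S T J.+1).
  exact: adapted_from_stable.
have [A [Z [A' [Z' tl]]]] := IH (ltnW dJ).
by apply: adapted_from_pred; rewrite subnSK //; exact: tl.
Qed.

End AdaptedFrom.

(** * From adapted chains to decomposition systems *)

(** Given C = Rt_S 1 and Z = X2, the subspace Xt is S'(C) for a generalized inverse
S' of S: as R(S) is the direct sum of R_S 2 = S(Z) and C, and S is injective
on Z + S'(C), the space X is the direct sum of N(S), Z and S'(C). *)
Lemma decomposition_half {K : numFieldType} {X Y : normedModType K}
    (S : {linear X -> Y}) (T : {linear Y -> X}) (C : set Y) (Z : set X) :
  regular_fredholm_pair S T -> is_subspace C -> closed C ->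
  splits (R_S S T 1) (R_S S T 2) C -> is_subspace Z -> Z `<=` R_T S T 1 ->
  splits (R_T S T 1) (R_T S T 1 `&` null_space S) (R_T S T 1 `&` Z) ->
  let NR := null_space S `&` range T in
  exists X1 Xt,
    [/\ [/\ fin_dim X1, fin_dim Z & is_subspace Xt /\ closed Xt],
        [/\ direct_sum (null_space S) [:: NR; X1], direct_sum (range T) [:: NR; Z]
          & direct_sum setT [:: NR; X1; Z; Xt]],
        S @` Xt = C &
        exists2 g : Y -> X, continuous g & forall x, Xt x -> g (S x) = x].
Proof.
move=> [cS _ [fN fR _ _] [S' cS' SS'] _] sC cC [CR' CR Cs C0] sZ ZR splZ.
set N := null_space S; set NR := N `&` range T => /=.
have sN : is_subspace N := subspace_null S.
have [_ sR] := subspace_R S T 1.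
have sNR : is_subspace NR by exact: subspaceI.
have {}splZ : splits (range T) NR Z.
  by move: splZ; rewrite (setIidr ZR) [_ `&` null_space S]setIC.
have [_ _ Zs Z0] := splZ.
have [s Ns] := finite_dim_quotient_cospan fN.
have [t] := exists_complement sNR sN Ns.
have := fin_dim_cospan (K := K) t; set X1 := cospan _ t => fX1.
rewrite /NR setIA setIid -/NR => splX1.
have fZ : fin_dim Z.
  have [r Rr] := finite_dim_quotient_cospan fR.
  have [u [_ _ Zu _]] := exists_complement sNR sZ (subset_trans ZR Rr).
  split=> //; exists u => x /Zu[a [b [[Za NRa] ub ->]]].
  by rewrite (Z0 a) // add0r.
have SS'y y : R_S S T 1 y -> S (S' y) = y by move=> [x _ <-]; rewrite -SS'.
pose Xt := S' @` C.
have gXt x : Xt x -> S' (S x) = x by move=> [c Cc <-]; rewrite SS'y //; exact: CR.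
have XtE : Xt = [set x | (S' \o S) x = x] `&` S @^-1` C.
  apply/seteqP; split=> [x Xtx|x [/= Sx Cx]]; last by exists (S x).
  by split; [exact: gXt|case: Xtx => c Cc <-; rewrite /= SS'y //; exact: CR].
have sXt : is_subspace Xt by exact: subspace_image.
have cXt : closed Xt.
  rewrite XtE; apply: closedI; last exact: closed_preimage.
  by apply: closed_fixed => x; apply: continuous_comp; [exact: cS|exact: cS'].
have SXt : S @` Xt = C.
  apply/seteqP; split=> [_ [_ [c Cc <-] <-]|c Cc]; first by rewrite SS'y //; exact: CR.
  by exists (S' c); [exists c|rewrite SS'y //; exact: CR].
have [sX1 _] := fX1.
have SXtC x : Xt x -> C (S x) by rewrite -SXt => Xtx; exists x.
have ZNx x : Z x -> S x = 0 -> x = 0.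
  by move=> Zx Sx; apply: Z0 => //; split=> //; exact: ZR.
have RS2 x : Z x -> R_S S T 2 (S x) by move=> Zx; exists x => //; exact: ZR.
have C2 z x : Z z -> Xt x -> S (z + x) = 0 -> z = 0 /\ x = 0.
  move=> Zz Xtx; rewrite linearD => /eqP; rewrite addr_eq0 => /eqP Szx.
  have Sx0 : S x = 0.
    apply: C0; last exact: SXtC.
    rewrite -[S x]opprK -Szx; apply: subspaceN; last exact: RS2.
    by have [] := subspace_R S T 2.
  split; first by apply: ZNx => //; rewrite Szx Sx0 oppr0.
  by rewrite -(gXt x) // Sx0 linear0.
have splXt : splits (add_set Z Xt) Z Xt.
  split.
  - exact: sub_addl.
  - exact: sub_addr.
  - by move=> _ [z Zz [x Xtx <-]]; exists z, x.
  - move=> x Zx Xtx; have [] // := C2 x (- x) Zx (subspaceN sXt Xtx).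
    by rewrite subrr linear0.
have splX : splits setT N (add_set Z Xt).
  split=> // [x _|x Nx [z Zz [w Xtw xE]]]; last first.
    by have [] := C2 z w Zz Xtw; [rewrite xE|move=> z0 w0; rewrite -xE z0 w0 addr0].
  - have [_ [c [[u Ru <-] Cc Sx]]] := Cs _ (imageP S (I : setT x)).
    have [n [z [[Nn _] Zz uE]]] := Zs _ Ru.
    exists (x - (z + S' c)), (z + S' c); split; last by rewrite subrK.
      rewrite /N /null_space /= linearB linearD SS'y; last exact: CR.
      by rewrite Sx uE linearD Nn add0r subrr.
    by exists z => //; exists (S' c) => //; exists c.
have sZXt := subspace_add sZ sXt.
exists X1, Xt; split=> //; last by exists S'.
split.
- exact: splits_direct_sum.
- exact: splits_direct_sum.
- have dN : direct_sum N [:: NR; X1] by exact: splits_direct_sum.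
  have dZ : direct_sum (add_set Z Xt) [:: Z; Xt] by exact: splits_direct_sum.
  have dX : direct_sum setT [:: N; add_set Z Xt].
    by apply: splits_direct_sum => //; exact: subspace_setT.
  have := direct_sum_subst (l := [:: N]) (r := [:: Z; Xt]) (r' := [::])
    (conj sN I) sZXt (conj sZ (conj sXt I)) I dX dZ => dX'.
  by have := direct_sum_subst (l := [::]) (r := [:: NR; X1]) (r' := [:: Z; Xt]) I sN
    (conj sNR (conj sX1 I)) (conj sZ (conj sXt I)) dX' dN.
Qed.

(** F m = E m + F (m+1) = E m + E (m+1) + F (m+2) = ... *)
Lemma direct_sum_chain {K : numFieldType} {V : normedModType K}
    (F E : nat -> set V) m k :
  (forall i, is_subspace (F i)) -> (forall i, is_subspace (E i)) ->
  (forall i, (m <= i)%N -> splits (F i) (E i) (F i.+1)) ->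
  direct_sum (F m) ([seq E i | i <- iota m k] ++ [:: F (m + k)%N]).
Proof.
move=> sF sE; elim: k m => [|k IH] m spl.
  rewrite addn0; split; rewrite /= ?add_set0 //; split=> //.
  by rewrite setIidr // => _ ->; exact: subspace0.
have d : direct_sum (F m) [:: E m; F m.+1] by exact: splits_direct_sum (spl _ _).
have := direct_sum_subst (l := [:: E m]) (r' := [::]) _ _ _ _ d (IH m.+1 _).
rewrite cats0 /= addSnnS; apply=> //.
- apply/subspaces_cat; split; first exact: subspaces_map.
  by split.
- by move=> i mi; apply: spl; exact: ltnW.
Qed.

(** The coarse decomposition of V into N & R, X1, Z and Xt is refined: N & R, which
is U 1 & N, and Z are resolved along the chain U, and Xt is cut in two.  The kernel
parts die out at level k+1, whereas Z is resolved up to any level m. *)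
Lemma refined_decomposition {K : numFieldType} {V W : normedModType K}
    (S : {linear V -> W}) (U A : nat -> set V) (Z X1 Xt Xa Xb : set V) k m :
  let N := null_space S in
  (forall i, is_subspace (U i)) -> (forall i, is_subspace (A i)) ->
  is_subspace Z -> is_subspace X1 -> is_subspace Xt -> is_subspace Xa ->
  is_subspace Xb -> Z `<=` U 1%N ->
  (forall i, (1 <= i)%N -> stage S (U i) (U i.+1) (A i) Z) ->
  U k.+1 `&` N = [set 0] -> splits Xt Xa Xb ->
  direct_sum setT [:: N `&` U 1%N; X1; Z; Xt] ->
  direct_sum setT
    ((X1 :: [seq A i `&` N | i <- iota 1 k])
      ++ (U m.+1 `&` Z :: [seq A i `&` (U i `&` Z) | i <- iota 1 m])
      ++ [:: Xa; Xb]).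
Proof.
move=> N sU sA sZ sX1 sXt sXa sXb ZU st Uk0 splXt dX.
have sN : is_subspace N := subspace_null S.
have chain i : (1 <= i)%N ->
    splits (U i `&` N) (A i `&` N) (U i.+1 `&` N) /\
    splits (U i `&` Z) (A i `&` (U i `&` Z)) (U i.+1 `&` Z).
  move=> i1; have AU : A i `<=` U i by case: (st i i1) => _ [].
  rewrite setIA (setIidl AU).
  by apply: stage_chain (st i i1) (st i.+1 _).
set LN := [seq A i `&` N | i <- iota 1 k].
set LZ := [seq A i `&` (U i `&` Z) | i <- iota 1 m].
have sLN : subspaces LN by apply: subspaces_map => i; exact: subspaceI.
have sLZ : subspaces LZ by apply: subspaces_map => i; do 2 apply: subspaceI => //.
have dN : direct_sum (N `&` U 1%N) LN.
  apply: direct_sum_rcons0 => //; rewrite setIC -Uk0.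
  apply: (@direct_sum_chain _ _ (fun i => U i `&` N) (fun i => A i `&` N)) => i.
  - exact: subspaceI.
  - exact: subspaceI.
  - by move=> /chain[].
have dZ : direct_sum Z (U m.+1 `&` Z :: LZ).
  apply: (@direct_sum_catC _ _ _ LZ [:: U m.+1 `&` Z]) => //.
    by split=> //; exact: subspaceI.
  have <- : U 1%N `&` Z = Z by exact: setIidr.
  rewrite {2}(setIidr ZU).
  apply: (@direct_sum_chain _ _ (fun i => U i `&` Z) (fun i => A i `&` (U i `&` Z))) => i.
  - exact: subspaceI.
  - by do 2 apply: subspaceI => //.
  - by move=> /chain[].
have sNU : is_subspace (N `&` U 1%N) by exact: subspaceI.
have {}dX : direct_sum setT ([:: X1] ++ (N `&` U 1%N) :: [:: Z; Xt]).
  by apply: (@direct_sum_catCA _ _ _ [:: N `&` U 1%N] [:: X1] [:: Z; Xt]).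
have {}dX := direct_sum_subst (l := [:: X1]) (r' := [:: Z; Xt])
  (conj sX1 I) sNU sLN (conj sZ (conj sXt I)) dX dN.
rewrite catA in dX.
have sXN : subspaces ([:: X1] ++ LN) by apply/subspaces_cat.
have {}dX := direct_sum_subst (r := U m.+1 `&` Z :: LZ) (r' := [:: Xt])
  sXN sZ (conj (subspaceI (sU _) sZ) sLZ) (conj sXt I) dX dZ.
rewrite catA in dX.
have sXNZ : subspaces (([:: X1] ++ LN) ++ U m.+1 `&` Z :: LZ).
  by apply/subspaces_cat; split=> //; split=> //; exact: subspaceI.
have := direct_sum_subst (r := [:: Xa; Xb]) (r' := [::]) sXNZ sXt (conj sXa (conj sXb I)) I dX
  (splits_direct_sum sXt sXa sXb splXt).
by rewrite -!catA /=.
Qed.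

(** * The case III decomposition *)

Section AdaptedSystem.
Context {K : numFieldType} {X Y : normedModType K}.
Variables (S : {linear X -> Y}) (T : {linear Y -> X}).
Lemma exists_staged_system A Z A' Z' :
  regular_fredholm_pair S T -> adapted_from S T 1 A Z A' Z' ->
  exists D : system X Y,
    [/\ decomposition_system S T D,
        forall n, (1 <= n)%N ->
          stage T (R_S S T n) (R_S S T n.+1) (Rt_S S T D n) (Y2 D),
        forall n, (1 <= n)%N ->
          stage S (R_T S T n) (R_T S T n.+1) (Rt_T S T D n) (X2 D),
        exists2 g : Y -> X, continuous g & forall x, Xt D x -> g (S x) = x &
        exists2 g : X -> Y, continuous g & forall y, Yt D y -> g (T y) = y].
Proof.
move=> rST [hS hT [sZ ZR] [sZ' ZR']].
have rTS := regular_fredholm_pair_sym rST.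
have [[sA cA] splA _ splZ] := hS 0%N; have [[sA' cA'] splA' _ splZ'] := hT 0%N.
have [X1 [Xt [[fX1 fX2 cXt] [dN dR dX] SXt gX]]] :=
  decomposition_half rST sA cA splA sZ' ZR' splZ'.
have [Y1 [Yt [[fY1 fY2 cYt] [dN' dR' dY] TYt gY]]] :=
  decomposition_half rTS sA' cA' splA' sZ ZR splZ.
exists (System X1 Z' Xt Y1 Z Yt); split => //.
- by split=> //; exact: fin_dim_finite_dim.
- case=> // n _; have := hS n.
  by rewrite /Rt_S (alt_shift S T Xt Yt n).1 SXt TYt.
- case=> // n _; have := hT n.
  by rewrite /Rt_T (alt_shift S T Xt Yt n).2 SXt TYt.
Qed.

Lemma staged_adapted (D : system X Y) : decomposition_system S T D ->
  (forall n, (1 <= n)%N ->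
          stage T (R_S S T n) (R_S S T n.+1) (Rt_S S T D n) (Y2 D)) ->
  (forall n, (1 <= n)%N ->
          stage S (R_T S T n) (R_T S T n.+1) (Rt_T S T D n) (X2 D)) ->
  adapted S T D.
Proof.
move=> dD hS hT n n1.
have half (V W : normedModType K) (f : {linear V -> W}) (U U1 A Z : set V) :
    is_subspace U -> is_subspace U1 -> is_subspace Z -> stage f U U1 A Z ->
    [/\ direct_sum U [:: U `&` null_space f; U `&` Z],
        direct_sum A [:: A `&` null_space f; A `&` (U `&` Z)] &
        direct_sum U [:: U1; A]].
  move=> sU sU1 sZ [[sA _] splU splA splN].
  have sN := subspace_null f.
  rewrite setIA (setIidl (_ : A `<=` U)); last by case: splU.
  by split; apply: splits_direct_sum => //; exact: subspaceI.
have [sY2 _] := dec_Y2 dD; have [sX2 _] := dec_X2 dD.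
have [sS sT] := subspace_R S T n; have [sS1 sT1] := subspace_R S T n.+1.
have [? ? ?] := half _ _ T _ _ _ _ sS sS1 sY2 (hS n n1).
have [? ? ?] := half _ _ S _ _ _ _ sT sT1 sX2 (hT n n1).
by split.
Qed.

End AdaptedSystem.

Lemma splits_trivial {K : numFieldType} {V : normedModType K} (U A B : set V) :
  A = [set 0] -> splits U A B -> U = B.
Proof.
move=> -> [_ BU UB _]; apply/seteqP; split=> // u /UB[a [b [-> Bb ->]]].
by rewrite add0r.
Qed.

Lemma stage_image {K : numFieldType} {V W : normedModType K}
    (T : {linear V -> W}) (U U1 A Z : set V) :
  stage T U U1 A Z -> T @` (A `&` (U `&` Z)) = T @` A.
Proof.
move=> [[sA _] [_ AU _ _] splA _].
by rewrite setIA (setIidl AU); exact: splits_image.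
Qed.

Theorem theorem3p12 (R : realType) (K : numFieldType) (hK : scalar_field R K)
    (X Y : completeNormedModType K)
    (S : {linear X -> Y}) (T : {linear Y -> X})
    (hST : regular_fredholm_pair S T)
    (q : nat) (hcase : has_case S T CaseIII q) (hq : (2 <= q)%N) :
  exists D : system X Y,
    let NX := X1 D :: [seq NN S T D i | i <- iota 1%N (q - 1)%N] in
    let MY := Y1 D :: [seq MM S T D j | j <- iota 1%N q] in
    decomposition_system S T D /\ adapted S T D /\
    direct_sum setT
      (NX ++ (X2n S T D q :: [seq XX2 S T D i | i <- iota 1%N (q - 1)%N])
          ++ [:: XtN S T D; Xt2 S T D]) /\
    direct_sum setT
      (MY ++ (Y2n S T D (q - 1)%N :: [seq YY2 S T D j | j <- iota 1%N (q - 2)%N])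
          ++ [:: YtN S T D; Yt2 S T D]) /\
    (* action of S *)
    (forall x, sum_set NX x -> S x = 0) /\
    banach_iso S (X2n S T D q) (Y2n S T D (q - 1)%N) /\
    (forall i, (1 <= i <= q - 3)%N ->
       independent [:: MM S T D i.+1; YY2 S T D i.+1] /\
       banach_iso S (XX2 S T D i)
         (sum_set [:: MM S T D i.+1; YY2 S T D i.+1])) /\
    (forall k, (1 <= k)%N -> k = (q - 2)%N \/ k = (q - 1)%N ->
       banach_iso S (XX2 S T D k) (MM S T D k.+1)) /\
    banach_iso S (XtN S T D) (MM S T D 1%N) /\
    banach_iso S (Xt2 S T D) (YY2 S T D 1%N) /\
    (* action of T *)
    (forall y, sum_set MY y -> T y = 0) /\
    banach_iso T (Y2n S T D (q - 1)%N) (X2n S T D q) /\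
    (forall j, (1 <= j <= q - 2)%N ->
       independent [:: NN S T D j.+1; XX2 S T D j.+1] /\
       banach_iso T (YY2 S T D j)
         (sum_set [:: NN S T D j.+1; XX2 S T D j.+1])) /\
    banach_iso T (YtN S T D) (NN S T D 1%N) /\
    banach_iso T (Yt2 S T D) (XX2 S T D 1%N) /\
    (q = 2%N -> YY2 S T D 1%N = [set 0] /\ Xt2 S T D = [set 0]).
Proof.
have sepX : functionals_separate X := scalar_field_functionals_separate hK (V := X).
have sepY : functionals_separate Y := scalar_field_functionals_separate hK (V := Y).
have [cS cT _ _ _] := hST.
have stT l : R_T S T (q + l) = R_T S T q.
  have [p [q0 [_ [[_ stq] _] -> qp]]] := hcase.
  by rewrite (minn_idPr (ltnW qp)) -stq.
have stS l : R_S S T (q.+1 + l) = R_S S T q.+1.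
  have R_SS n : R_S S T n.+1 = S @` R_T S T n by [].
  by rewrite addSn !R_SS stT.
(* Both chains are constant from q+1 on, where the descending construction starts. *)
case: q hcase hq stT stS => [|[|r]] // _ _ stT stS.
rewrite !subSS !subn0.
have fT : fin_dim (R_T S T r.+2).
  rewrite -(R_sym S T _).1; apply: R_S_fin_dim.
  exact: regular_fredholm_pair_sym.
have injS x : R_T S T r.+2 x -> T (S x) = 0 -> x = 0.
  apply: (fin_dim_surj_inj (f := T \o S) fT).
  by rewrite -[RHS](stT 2%N) addn2 -image_comp.
have NS0 : R_T S T r.+2 `&` null_space S = [set 0].
  have [_ sT] := subspace_R S T r.+2; have sN := subspace_null S.
  rewrite setI_trivialE // => x Rx Sx; apply: injS => //.
  by rewrite (Sx : S x = 0) linear0.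
have NT0 : R_S S T r.+3 `&` null_space T = [set 0].
  have [sS _] := subspace_R S T r.+3; have sN := subspace_null T.
  rewrite setI_trivialE // => _ [x Rx <-] TSx.
  by rewrite (injS x) // linear0.
have [A [Z [A' [Z' tl]]]] : exists A Z A' Z', adapted_from S T 1 A Z A' Z'.
  apply: (exists_adapted_from sepX sepY hST (isT : (1 <= r.+3)%N)) => //.
  - by move=> k; rewrite addSn -addnS !stT -(stT 1) addn1.
  - by have := stT 1; rewrite addn1 => ->.
have [D [dD hS hT [gX cgX gXt] [gY cgY gYt]]] := exists_staged_system hST tl.
exists D => NX MY.
have aD := staged_adapted dD hS hT.
have sR_S n : is_subspace (R_S S T n) by have [] := subspace_R S T n.
have sR_T n : is_subspace (R_T S T n) by have [] := subspace_R S T n.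
have [[sXt cXt] [sYt cYt]] := (dec_Xt dD, dec_Yt dD).
have [[sX1 _] [sY1 _]] := (dec_X1 dD, dec_Y1 dD).
have [fX2 fY2] := (finite_dim_fin_dim (dec_X2 dD), finite_dim_fin_dim (dec_Y2 dD)).
have [[sX2 _] [sY2 _]] := (fX2, fY2).
have [sNS sNT] := (subspace_null S, subspace_null T).
have sAB n := subspace_alt S T n sXt sYt.
have [_ X1N] := direct_sum_sub (subspaceI sNS (sR_T 1%N)) sX1 (dec_NS dD).
have [_ X2R] := direct_sum_sub (subspaceI sNS (sR_T 1%N)) sX2 (dec_RT dD).
have [_ Y1N] := direct_sum_sub (subspaceI sNT (sR_S 1%N)) sY1 (dec_NT dD).
have [_ Y2R] := direct_sum_sub (subspaceI sNT (sR_S 1%N)) sY2 (dec_RS dD).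
have injX2 x : X2 D x -> S x = 0 -> x = 0.
  move=> Xx Sx; have [_ _ _ [_ _ _]] := hT 1%N isT.
  by apply; split=> //; exact: X2R.
have injY2 y : Y2 D y -> T y = 0 -> y = 0.
  move=> Yy Ty; have [_ _ _ [_ _ _]] := hS 1%N isT.
  by apply; split=> //; exact: Y2R.
(* A constant chain leaves no room for complements: Rt_T j lies in R_T (j+1). *)
have RtT0 j : (r.+2 <= j)%N -> Rt_T S T D j = [set 0].
  move=> qj; have [[sA _] [_ AU _ U0] _ _] := hT j (leq_ltn_trans (leq0n _) qj).
  apply/seteqP; split=> [x Ax|_ ->]; last exact: subspace0.
  apply: U0 => //; move: (AU _ Ax).
  by rewrite -(subnKC qj) -addnS !stT.
(* T is injective on Y2 and maps YY2 j into Rt_T (j+1) = 0. *)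
have YY20 j : (r.+1 <= j)%N -> YY2 S T D j = [set 0].
  move=> rj; apply/seteqP; split=> [y [Ry [Rty Yy]]|_ ->]; last first.
    by apply: subspace0; apply: subspaceI; [exact: (sAB j).1|exact: subspaceI].
  apply: injY2 => //; have : Rt_T S T D j.+1 (T y) by exists y.
  by rewrite RtT0.
have injXt x : Xt D x -> S x = 0 -> x = 0.
  move=> Xx Sx; rewrite -(gXt x) // Sx -(linear0 S) gXt //; exact: subspace0.
have injYt y : Yt D y -> T y = 0 -> y = 0.
  move=> Yy Ty; rewrite -(gYt y) // Ty -(linear0 T) gYt //; exact: subspace0.
have isoX2 B : is_subspace B -> B `<=` X2 D -> banach_iso S B (S @` B).
  move=> sB BX; apply: fin_dim_banach_iso => // [|x /BX]; last exact: injX2.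
  exact: fin_dim_sub fX2.
have isoY2 B : is_subspace B -> B `<=` Y2 D -> banach_iso T B (T @` B).
  move=> sB BY; apply: fin_dim_banach_iso => // [|y /BY]; last exact: injY2.
  exact: fin_dim_sub fY2.
have sMM n : is_subspace (MM S T D n) by apply: subspaceI => //; exact: (sAB n).1.
have sNN n : is_subspace (NN S T D n) by apply: subspaceI => //; exact: (sAB n).2.
have sY2n n : is_subspace (Y2n S T D n) by exact: subspaceI.
have sX2n n : is_subspace (X2n S T D n) by exact: subspaceI.
have sYY n : is_subspace (YY2 S T D n) by apply: subspaceI => //; exact: (sAB n).1.
have sXX n : is_subspace (XX2 S T D n) by apply: subspaceI => //; exact: (sAB n).2.
have cMM : closed (MM S T D 1).
  by have [[_ cA] _ _ _] := hS 1%N isT; apply: closedI => //; exact: closed_null.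
have cNN : closed (NN S T D 1).
  by have [[_ cA] _ _ _] := hT 1%N isT; apply: closedI => //; exact: closed_null.
have cYY : closed (YY2 S T D 1).
  by apply: fin_dim_closed => //; apply: fin_dim_sub fY2 => // y [_ []].
have cXX : closed (XX2 S T D 1).
  by apply: fin_dim_closed => //; apply: fin_dim_sub fX2 => // x [_ []].
have isoXX i : banach_iso S (XX2 S T D i.+1) (Rt_S S T D i.+2).
  rewrite (_ : Rt_S S T D i.+2 = S @` XX2 S T D i.+1); last first.
    by rewrite (stage_image (hT i.+1 isT)).
  by apply: isoX2 => // x [_ []].
have isoYY i : banach_iso T (YY2 S T D i.+1) (Rt_T S T D i.+2).
  rewrite (_ : Rt_T S T D i.+2 = T @` YY2 S T D i.+1); last first.
    by rewrite (stage_image (hS i.+1 isT)).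
  by apply: isoY2 => // x [_ []].
have Rt_SE n : Rt_S S T D n.+1 = sum_set [:: MM S T D n.+1; YY2 S T D n.+1].
  by have [_ [] ] := aD n.+1 isT.
have Rt_TE n : Rt_T S T D n.+1 = sum_set [:: NN S T D n.+1; XX2 S T D n.+1].
  by have [_ _ [] ] := aD n.+1 isT.
(* The stable subspaces meet the null spaces trivially, so they lie in X2 and Y2.
   As YY2 vanishes from level r+1 on, the intersection of Y2 with R_S (r+1) is no
   larger than the stable subspace R_S (r+3). *)
have X2nq : R_T S T r.+2 = X2n S T D r.+2.
  by have [_ _ _] := hT r.+2 isT; exact: splits_trivial.
have Y2nq : R_S S T r.+3 = Y2n S T D r.+1.
  have Y2nS j : (r <= j)%N -> Y2n S T D j.+1 = Y2n S T D j.+2.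
    move=> rj; have [_] := stage_chain (sR_S j.+1) sY2 (hS j.+1 isT) (hS j.+2 isT).
    apply: splits_trivial; rewrite -(YY20 j.+1) // /YY2 /Y2n setIA.
    by rewrite (setIidl (_ : _ `<=` R_S S T j.+1)) //; case: (hS j.+1 isT) => _ [].
  rewrite Y2nS // Y2nS //.
  by have [_ _ _] := hS r.+3 isT; exact: splits_trivial.
have splXt : splits (Xt D) (XtN S T D) (Xt2 S T D).
  apply: splits_preimage => //; have [_ [_ AU _ _] splA _] := hS 1%N isT.
  by rewrite /YY2 /Y2n setIA (setIidl AU).
have splYt : splits (Yt D) (YtN S T D) (Yt2 S T D).
  apply: splits_preimage => //; have [_ [_ AU _ _] splA _] := hT 1%N isT.
  by rewrite /XX2 /X2n setIA (setIidl AU).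
split=> //; split=> //; split.
  have [sXN sX2'] := (subspace_restricted_preimage S sXt (sMM 1%N),
    subspace_restricted_preimage S sXt (sYY 1%N)).
  exact: (refined_decomposition _ sR_T (fun i => (sAB i).2) sX2 sX1 sXt sXN sX2'
    X2R hT NS0 splXt (dec_X dD)).
split.
  have [sYN sY2'] := (subspace_restricted_preimage T sYt (sNN 1%N),
    subspace_restricted_preimage T sYt (sXX 1%N)).
  exact: (refined_decomposition _ sR_S (fun i => (sAB i).1) sY2 sY1 sYt sYN sY2'
    Y2R hS NT0 splYt (dec_Y dD)).
split.
  by apply: (sum_set_sub sNS X1N) => i z [].
split.
  rewrite -Y2nq (_ : R_S S T r.+3 = S @` X2n S T D r.+2) -?X2nq //.
  by rewrite X2nq; apply: isoX2 => // x [].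
split.
  case=> // i _; rewrite -Rt_SE; split; last exact: isoXX.
  by have [_ [] ] := aD i.+2 isT.
split.
  case=> // k _ kr; have := isoXX k; rewrite Rt_SE YY20 /= ?add_set0 //.
  by case: kr => [<-|[<-]].
split; first by apply: restricted_preimage_banach_iso cgX _ _ _ _ => // y [].
split; first by apply: restricted_preimage_banach_iso cgX _ _ _ _ => // y [].
split.
  by apply: (sum_set_sub sNT Y1N) => j z [].
split.
  have -> : X2n S T D r.+2 = T @` Y2n S T D r.+1.
    rewrite -X2nq; apply/esym; have [_ _ _] := hS r.+1 isT.
    exact: splits_image.
  by apply: isoY2 => // x [].
split.
  case=> // j _; rewrite -Rt_TE; split; last exact: isoYY.
  by have [_ _ [] ] := aD j.+2 isT.
split; first by apply: restricted_preimage_banach_iso cgY _ _ _ _ => // y [].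
split; first by apply: restricted_preimage_banach_iso cgY _ _ _ _ => // y [].
move=> [r0]; have YY0 : YY2 S T D 1 = [set 0] by apply: YY20; rewrite r0.
split=> //; rewrite /Xt2 YY0; apply/seteqP; split=> [x [Xx Sx]|_ ->].
  exact: injXt.
by split; [exact: subspace0|exact: linear0].
Qed.
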